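(* Let $D$ be a delta-matroid on $[n,\overline{n}]$ which has an enveloping matroid. Then the polynomial $$\sum_{S\text{ independent in }D}w_0^{2n-|S|}\,w^{\underline{S}}\in\mathbb{R}[w_0,w_1,\dots,w_n]$$ is Lorentzian.
   Context: Let $[n,\overline{n}]=\{1,\dots,n,\overline{1},\dots,\overline{n}\}$ with involution $a\mapsto\overline{a}$; $\overline{S}=\{\overline{a}:a\in S\}$. A subset is admissible if it contains at most one of $i,\overline{i}$ for each $i$; $\operatorname{AdS}_n$ is the set of admissible subsets. In $\mathbb{R}^n$ set $e_{\overline{i}}=-e_i$, $e_S=\sum_{a\in S}e_a$. A delta-matroid $D$ on $[n,\overline{n}]$ is a nonempty collection $\mathcal{F}$ of admissible sets of size $n$ (feasible sets) such that $P(D)=\operatorname{Conv}\{e_B:B\in\mathcal{F}\}$ has all edges parallel to some $e_i$ or $e_i\pm e_j$. An admissible set $S$ is independent in $D$ if it is contained in a feasible set (equivalently $\max_{B\in\mathcal{F}}(|S\cap B|-|\overline{S}\cap B|)=|S|$). For admissible $S$, $\underline{S}\subseteq[n]$ is its unsigned version (image under identifying $i$ with $\overline{i}$), and $w^T=\prod_{a\in T}w_a$. For $S\subseteq[n,\overline{n}]$ let $u_S\in\mathbb{R}^{[n,\overline{n}]}$ be its indicator vector; for a matroid $M$ on $[n,\overline{n}]$ let $P(M)=\operatorname{Conv}\{u_B:B\text{ a basis of }M\}$; let $\operatorname{env}(x_1,\dots,x_n,x_{\overline{1}},\dots,x_{\overline{n}})=(x_1-x_{\overline{1}},\dots,x_n-x_{\overline{n}})$.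 $M$ is an enveloping matroid for $D$ if $\operatorname{env}(P(M))=P(D)$. A homogeneous polynomial $f$ of degree $d$ with real coefficients is strictly Lorentzian if all its coefficients (of all degree-$d$ monomials) are positive and, for every choice of $d-2$ partial derivatives, the resulting quadratic form is nondegenerate with exactly one positive eigenvalue; $f$ is Lorentzian if it is a coefficient-wise limit of strictly Lorentzian polynomials. *)

(* Defs.v *)
From HB Require Import structures.
From mathcomp Require Import all_boot all_order all_algebra.
From mathcomp Require Import reals.
From mathcomp Require Import mpoly.

Set Implicit Arguments.
Unset Strict Implicit.
Unset Printing Implicit Defensive.

Import Order.TTheory GRing.Theory Num.Theory.
Local Open Scope ring_scope.

(* (i, false) stands for i, (i, true) stands for ibar. *)
Definition gset (n : nat) : finType := ('I_n * bool)%type.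

Definition gbar (n : nat) (a : gset n) : gset n := (a.1, ~~ a.2).

Definition admissible (n : nat) (S : {set gset n}) : bool :=
  [forall i : 'I_n, ~~ (((i, false) \in S) && ((i, true) \in S))].

Definition unsigned (n : nat) (S : {set gset n}) : {set 'I_n} := [set a.1 | a in S].

Section Geometry.
Variable R : realType.

Definition e_elt (n : nat) (a : gset n) : 'rV[R]_n :=
  (if a.2 then -1 else 1) *: delta_mx 0 a.1.

Definition e_set (n : nat) (S : {set gset n}) : 'rV[R]_n := \sum_(a in S) e_elt a.

Definition dotv (n : nat) (c x : 'rV[R]_n) : R := \sum_(i < n) c 0 i * x 0 i.

Definition conv_hull (V : lmodType R) (I : finType) (A : {set I}) (v : I -> V)
    (x : V) : Prop :=
  exists lam : I -> R,
    (forall i, 0 <= lam i) /\ \sum_(i in A) lam i = 1 /\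
    x = \sum_(i in A) lam i *: v i.

Definition in_segment (n : nat) (u v x : 'rV[R]_n) : Prop :=
  exists t : R, 0 <= t /\ t <= 1 /\ x = u + t *: (v - u).

Definition is_edge (n : nat) (P : 'rV[R]_n -> Prop) (u v : 'rV[R]_n) : Prop :=
  u != v /\
  exists c : 'rV[R]_n,
    (forall x, P x -> dotv c x <= dotv c u) /\
    (forall x, (P x /\ dotv c x = dotv c u) <-> in_segment u v x).

Definition allowed_direction (n : nat) (d : 'rV[R]_n) : Prop :=
  (exists i : 'I_n, exists t : R, d = t *: delta_mx 0 i) \/
  (exists i j : 'I_n, i != j /\ exists t : R,
      d = t *: (delta_mx 0 i + delta_mx 0 j) \/
      d = t *: (delta_mx 0 i - delta_mx 0 j)).

Definition PD (n : nat) (F : {set {set gset n}}) (x : 'rV[R]_n) : Prop :=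
  conv_hull F (@e_set n) x.

Definition delta_matroid (n : nat) (F : {set {set gset n}}) : Prop :=
  F != set0 /\
  (forall B, B \in F -> admissible B /\ #|B| = n) /\
  (forall u v, is_edge (PD F) u v -> allowed_direction (v - u)).

Definition indic (n : nat) (S : {set gset n}) : {ffun gset n -> R^o} :=
  [ffun a => (a \in S)%:R].

Definition PM (n : nat) (Bs : {set {set gset n}}) (x : {ffun gset n -> R}) : Prop :=
  @conv_hull {ffun gset n -> R^o} _ Bs (@indic n) x.

Definition env (n : nat) (x : {ffun gset n -> R}) : 'rV[R]_n :=
  \row_i (x (i, false) - x (i, true)).

Definition enveloping (n : nat) (F Bs : {set {set gset n}}) : Prop :=
  forall y : 'rV[R]_n, (exists x, PM Bs x /\ y = env x) <-> PD F y.

End Geometry.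

Definition matroid_bases (T : finType) (Bs : {set {set T}}) : Prop :=
  Bs != set0 /\
  forall B1 B2, B1 \in Bs -> B2 \in Bs ->
    forall x, x \in B1 :\: B2 ->
      exists2 y, y \in B2 :\: B1 & (y |: (B1 :\ x)) \in Bs.

Definition independent (n : nat) (F : {set {set gset n}}) (S : {set gset n}) : bool :=
  admissible S && [exists B in F, S \subset B].

Section Lorentzian.
Variable R : realType.

(* matrix of the quadratic form q (q(x) = x^T A x): half the Hessian *)
Definition quad_matrix (k : nat) (q : {mpoly R[k]}) : 'M[R]_k :=
  \matrix_(i, j) (2^-1 * ((q^`M(j))^`M(i)).@[fun _ => 0]).

Definition nondeg_one_pos (k : nat) (A : 'M[R]_k) : Prop :=
  \det A != 0 /\
  exists a : R, 0 < a /\ root (char_poly A) a /\ mup a (char_poly A) = 1%N /\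
    forall b : R, 0 < b -> root (char_poly A) b -> b = a.

Definition strictly_lorentzian (k d : nat) (f : {mpoly R[k]}) : Prop :=
  f \is d.-homog /\
  (forall m : 'X_{1..k}, mdeg m = d -> 0 < f@_m) /\
  ((2 <= d)%N -> forall s : seq 'I_k, size s = (d - 2)%N ->
     nondeg_one_pos (quad_matrix (foldr (fun i g => g^`M(i)) f s))).

Definition lorentzian (k d : nat) (f : {mpoly R[k]}) : Prop :=
  exists g : nat -> {mpoly R[k]},
    (forall N, strictly_lorentzian d (g N)) /\
    forall m : 'X_{1..k}, forall eps : R, 0 < eps ->
      exists N0 : nat, forall N, (N0 <= N)%N -> `|(g N)@_m - f@_m| < eps.

End Lorentzian.

(* sum_{S independent in D} w_0^{2n-|S|} w^{unsigned S} in R[w_0, ..., w_n];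
   variable 0 is w_0, variable (lift ord0 i) is w_{i+1}. *)
Definition indep_poly (R : realType) (n : nat) (F : {set {set gset n}}) : {mpoly R[n.+1]} :=
  \sum_(S : {set gset n} | independent F S)
     'X_(ord0) ^+ (2 * n - #|S|) * \prod_(i in unsigned S) 'X_(lift ord0 i).

(* Main.v *)
Require Import Defs.
From HB Require Import structures.
From mathcomp Require Import all_boot all_order all_algebra.
From mathcomp Require Import reals.
From mathcomp Require Import mpoly.
From mathcomp Require Import complex ring lra zify.

(* An admissible set is independent in [D] exactly when it is independent in the
   enveloping matroid [M]. In the multivariate Tutte polynomial of [M], rescaled so that
   a set [S] has weight [h ^ nullity S], every iterated coordinate derivative of order
   two less than the degree is a quadratic form with at most one positive eigenvalue:
   after normalisation this is a Cauchy-Schwarz inequality over the parallel classes of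
   a contraction. The same then holds for derivatives in positive directions, since
   [A = sum_k w_k T_k] with all slices [T_k] of a symmetric tensor of this kind satisfies
   [Q <= Q^2] for a rescaling [Q] of [A] with Perron eigenvalue 1, which forbids
   eigenvalues in the open interval (0, 1). Hence one may substitute positive linear
   forms close to [w_i, w_ibar := w_i].
   Multiplying the coefficient at exponent [alpha] by [h] to the power
   [sum_i binomial (alpha_i) 2], over the variables other than [w_0], shrinks the
   diagonals of the Hessians; this makes them nondegenerate and, as [h] tends to 0,
   removes the monomials that are not multiaffine in those variables, that is, those
   coming from non-admissible independent sets of [M]. *)

Set Implicit Arguments.
Unset Strict Implicit.
Unset Printing Implicit Defensive.

Import Order.TTheory GRing.Theory Num.Theory.
Local Open Scope ring_scope.

(** * Symmetric forms with at most one positive eigenvalue *)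

Section ReverseCauchySchwarz.
Variables (R : realFieldType) (K : finType).
Implicit Types (A : K -> K -> R) (x y w : K -> R).

Definition bform A x y : R := \sum_i \sum_j x i * A i j * y j.

(* For symmetric [A] this says that [A] has at most one positive eigenvalue. *)
Definition lor A := forall x y, 0 < bform A y y ->
  bform A x x * bform A y y <= bform A x y ^+ 2.

Lemma eq_bform A A' x x' y y' :
  A =2 A' -> x =1 x' -> y =1 y' -> bform A x y = bform A' x' y'.
Proof.
by move=> eA ex ey; apply: eq_bigr => i _; apply: eq_bigr => j _; rewrite eA ex ey.
Qed.

Lemma eq_lor A A' : A =2 A' -> lor A -> lor A'.
Proof.
move=> eA lA x y; rewrite -!(eq_bform eA (frefl _) (frefl _)).
exact: lA.
Qed.

Lemma bformDl A p q x x' y :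
  bform A (fun i => p * x i + q * x' i) y = p * bform A x y + q * bform A x' y.
Proof.
rewrite /bform !mulr_sumr -big_split; apply: eq_bigr => i _ /=.
by rewrite !mulr_sumr -big_split; apply: eq_bigr => j _ /=; ring.
Qed.

Lemma bformDr A p q x y y' :
  bform A x (fun i => p * y i + q * y' i) = p * bform A x y + q * bform A x y'.
Proof.
rewrite /bform !mulr_sumr -big_split; apply: eq_bigr => i _ /=.
by rewrite !mulr_sumr -big_split; apply: eq_bigr => j _ /=; ring.
Qed.

Lemma bformC A x y : (forall i j, A i j = A j i) -> bform A x y = bform A y x.
Proof.
move=> sA; rewrite /bform exchange_big; apply: eq_bigr => i _; apply: eq_bigr => j _.
by rewrite sA; ring.
Qed.

(** The vector [ly * x - lx * y] lies on the hyperplane, and [ly] is nonzero because the form is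
    positive at [y]. The form at that vector, times its value at [y], is
    [ly ^+ 2 * (a * c - b ^+ 2)] plus a square. *)
Lemma lor_of_hyperplane A (l : K -> R) : (forall i j, A i j = A j i) ->
  (forall x, \sum_i l i * x i = 0 -> bform A x x <= 0) -> lor A.
Proof.
move=> sA lA x y y0.
pose lx := \sum_i l i * x i; pose ly := \sum_i l i * y i.
have ly0 : ly != 0.
  by apply/eqP => l0; have := lA _ l0; rewrite leNgt y0.
have := lA (fun i => ly * x i + (- lx) * y i).
rewrite bformDl !bformDr (bformC y x sA).
have -> : \sum_i l i * (ly * x i + - lx * y i) = 0.
  transitivity (ly * lx - lx * ly); last by ring.
  rewrite {2}/lx {3}/ly !mulr_sumr -sumrB.
  by apply: eq_bigr => i _; ring.
move=> /(_ erefl); set a := bform A x x; set b := bform A x y.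
set c := bform A y y in y0 *.
move=> h; have {}h : (ly ^+ 2) * (a * c - b ^+ 2) + (ly * b - lx * c) ^+ 2 <= 0.
  have -> : ly ^+ 2 * (a * c - b ^+ 2) + (ly * b - lx * c) ^+ 2 =
    c * (ly * (ly * a + - lx * b) + - lx * (ly * b + - lx * c)) by ring.
  by rewrite pmulr_rle0.
have : (ly ^+ 2) * (a * c - b ^+ 2) <= 0.
  by apply: le_trans h; rewrite lerDl sqr_ge0.
rewrite pmulr_rle0; first by rewrite subr_le0.
by rewrite lt_def sqr_ge0 sqrf_eq0 ly0.
Qed.

Lemma sum_ge0_eq0 (F : K -> R) : (forall i, 0 <= F i) -> \sum_i F i = 0 ->
  forall i, F i = 0.
Proof. by move=> F0 /psumr_eq0P F_eq0 i; apply: F_eq0. Qed.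

Lemma finfun_solve A :
  (forall x, (forall i, \sum_j A i j * x j = 0) -> forall i, x i = 0) ->
  forall y, exists x, forall i, \sum_j A i j * x j = y i.
Proof.
move=> injA y; pose M : 'M[R]_#|K| := \matrix_(i, j) A (enum_val j) (enum_val i).
have uM : M \in unitmx.
  rewrite -row_free_unit -kermx_eq0; apply/eqP/row_matrixP => i; rewrite row0.
  have : row i (kermx M) *m M = 0 by rewrite -row_mul mulmx_ker row0.
  move: (row i (kermx M)) => v vM.
  have h : forall i, v 0 (enum_rank i) = 0.
    apply: (injA (fun i => v 0 (enum_rank i))) => k.
    have := congr1 (fun u : 'rV_#|K| => u 0 (enum_rank k)) vM.
    rewrite !mxE; apply: etrans.
    rewrite (reindex _ (onW_bij _ (@enum_val_bij K))) /=.
    by apply: eq_bigr => j _; rewrite !mxE enum_valK enum_rankK mulrC.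
  by apply/rowP => j; rewrite mxE -(enum_valK j) h.
pose v := (\row_j y (enum_val j)) *m invmx M.
exists (fun i => v 0 (enum_rank i)) => k.
have := congr1 (fun u : 'rV_#|K| => u 0 (enum_rank k)) (mulmxKV uM (\row_j y (enum_val j))).
rewrite !mxE enum_rankK; apply: etrans.
rewrite (reindex _ (onW_bij _ (@enum_val_bij K))) /=.
by apply: eq_bigr => j _; rewrite !mxE enum_valK enum_rankK mulrC.
Qed.

(* [w_i / (A w)_i] is the inverse of the Perron scaling [D]: the hypothesis says that
   the operator [D^-1 A], self-adjoint for the inner product [D], is at most its own
   square, while its top eigenvalue is 1 and simple. Where row [i] of [A] vanishes the
   junk value [x / 0 = 0] makes the [i]-th term of the sum vanish too. *)
Lemma lor_of_le_square A w :
  (forall i j, A i j = A j i) -> (forall i j, 0 <= A i j) -> (forall i, 0 < w i) ->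
  (forall i j, i != j -> A i j = 0 -> (forall k, A i k = 0) \/ (forall k, A j k = 0)) ->
  (forall x, bform A x x <=
     \sum_i w i * (\sum_j A i j * x j) ^+ 2 / (\sum_j A i j * w j)) ->
  lor A.
Proof.
move=> sA A0 w0 cA hA; pose u i := \sum_j A i j * w j.
have Aw0 i j : 0 <= A i j * w j by rewrite mulr_ge0 // ltW.
have u0 i : 0 <= u i by apply: sumr_ge0 => j _.
have uA i : u i = 0 -> forall k, A i k = 0.
  move=> ui k; have := sum_ge0_eq0 (Aw0 i) ui k.
  by move=> /eqP; rewrite mulf_eq0 (gt_eqF (w0 k)) orbF => /eqP.
case: (pickP (fun i => u i != 0)) => [i0 ui0|uz]; last first.
  have Az i j : A i j = 0 by apply: uA; apply/eqP; have := uz i; case: eqP.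
  move=> x y; rewrite {1}/bform big1 ?ltxx // => i _.
  by rewrite big1 // => j _; rewrite Az mulr0 mul0r.
pose D i := if u i == 0 then 1 else u i / w i.
have D0 i : 0 < D i.
  by rewrite /D; case: eqP => // /eqP ui; rewrite divr_gt0 // lt_def ui u0.
(* A weighted graph Laplacian: on the support of [u], the form [D - A] is half of [gap], hence
   nonnegative. *)
pose gap x := \sum_i \sum_j A i j * w i * w j * (x i / w i - x j / w j) ^+ 2.
have gapE x : gap x + 2 * \sum_i (if u i == 0 then x i ^+ 2 else 0) =
    2 * (\sum_i D i * x i ^+ 2 - bform A x x).
  have gapE1 : gap x = \sum_i u i / w i * x i ^+ 2 + \sum_i u i / w i * x i ^+ 2
      - 2 * bform A x x.
    rewrite /bform mulr_sumr /u.
    have e1 : \sum_i (\sum_j A i j * w j) / w i * x i ^+ 2 =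
        \sum_i \sum_j A i j * w j / w i * x i ^+ 2.
      by apply: eq_bigr => i _; rewrite !mulr_suml.
    rewrite {2}e1 exchange_big e1 -big_split -sumrB; apply: eq_bigr => i _ /=.
    rewrite mulr_sumr -big_split -sumrB; apply: eq_bigr => j _ /=.
    rewrite (sA j i); field.
    by rewrite !gt_eqF.
  rewrite gapE1.
  have -> : \sum_i D i * x i ^+ 2 =
      \sum_i u i / w i * x i ^+ 2 + \sum_i (if u i == 0 then x i ^+ 2 else 0).
    rewrite -big_split; apply: eq_bigr => i _ /=.
    by rewrite /D; case: eqP => [->|_]; rewrite ?mul0r ?addr0 ?add0r ?mul1r.
  by ring.
have gap_ge0 x i j : 0 <= A i j * w i * w j * (x i / w i - x j / w j) ^+ 2.
  exact: mulr_ge0 (mulr_ge0 (mulr_ge0 (A0 i j) (ltW (w0 i))) (ltW (w0 j))) (sqr_ge0 _).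
have gap0 x : 0 <= gap x by apply: sumr_ge0 => i _; apply: sumr_ge0 => j _.
have off0 x : 0 <= \sum_i (if u i == 0 then x i ^+ 2 else 0).
  by apply: sumr_ge0 => i _; case: ifP => // _; rewrite sqr_ge0.
have DA x : bform A x x <= \sum_i D i * x i ^+ 2.
  by have := gap0 x; have := off0 x; have := gapE x; lra.
apply: (lor_of_hyperplane sA (l := u)) => y uy.
(* The kernel of [D - A] is spanned by the Perron vector, [w] restricted to the support of [u].
   Adding the rank-one term [u u^T] removes it, so [L z = D y] can be solved. *)
pose L i j := (D i *+ (i == j) - A i j) + u i * u j.
have LE x i : \sum_j L i j * x j =
    D i * x i - \sum_j A i j * x j + u i * \sum_j u j * x j.
  rewrite mulr_sumr.
  have -> : D i * x i = \sum_j (D i *+ (i == j)) * x j.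
    rewrite (bigD1 i) //= eqxx big1 ?addr0 // => j.
    by rewrite eq_sym => /negbTE ->; rewrite mul0r.
  rewrite -sumrB -big_split; apply: eq_bigr => j _ /=; rewrite /L.
  by ring.
have bAE x x' : bform A x x' = \sum_i x i * \sum_j A i j * x' j.
  by apply: eq_bigr => i _; rewrite mulr_sumr; apply: eq_bigr => j _; ring.
have [z zP] : exists z, forall i, \sum_j L i j * z j = D i * y i.
  apply: finfun_solve => x Lx.
  have xLx : (\sum_i D i * x i ^+ 2 - bform A x x) + (\sum_j u j * x j) ^+ 2 = 0.
    transitivity (\sum_i x i * \sum_j L i j * x j).
      rewrite expr2 {1}mulr_suml bAE -sumrB -big_split.
      by apply: eq_bigr => i _ /=; rewrite LE; ring.
    by apply: big1 => i _; rewrite Lx mulr0.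
  have sq0 := sqr_ge0 (\sum_j u j * x j).
  have ux : \sum_j u j * x j = 0.
    by apply/eqP; rewrite -(sqrf_eq0 (\sum_j u j * x j)); apply/eqP; have := DA x; lra.
  have gx : gap x = 0 by have := gapE x; have := off0 x; have := gap0 x; have := DA x; lra.
  have ox : \sum_i (if u i == 0 then x i ^+ 2 else 0) = 0.
    by have := gapE x; have := off0 x; have := gap0 x; have := DA x; lra.
  have xoff i : u i = 0 -> x i = 0.
    move=> ui; have := sum_ge0_eq0 _ ox i; rewrite ui eqxx => h.
    apply/eqP; rewrite -(sqrf_eq0 (x i)); apply/eqP/h => j.
    by case: ifP => // _; rewrite sqr_ge0.
  (* A zero of [gap] has [x / w] constant on the support of [u]: by [cA], the entry of [A] at [i]
     and [i0] is nonzero whenever both rows are. *)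
  have xr i : u i != 0 -> x i = x i0 / w i0 * w i.
    move=> ui; case: (eqVneq i i0) => [->|ii0]; first by rewrite divfK ?gt_eqF.
    have gi : \sum_j A i j * w i * w j * (x i / w i - x j / w j) ^+ 2 = 0.
      by apply: (sum_ge0_eq0 _ gx i) => k; apply: sumr_ge0.
    have := sum_ge0_eq0 (gap_ge0 x i) gi i0.
    move=> /eqP; rewrite mulf_eq0 sqrf_eq0 subr_eq0 !mulf_eq0 !(gt_eqF (w0 _)) !orbF.
    case/orP => [/eqP Ai|/eqP <-]; last by rewrite divfK ?gt_eqF.
    have [Ak|Ak] := cA _ _ ii0 Ai.
      by case/eqP: ui; apply: big1 => k _; rewrite Ak mul0r.
    by case/eqP: ui0; apply: big1 => k _; rewrite Ak mul0r.
  have xi0 : x i0 / w i0 = 0.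
    have : x i0 / w i0 * (\sum_j u j * w j) = 0.
      rewrite mulr_sumr; apply: etrans ux; apply: eq_bigr => j _.
      by case: (eqVneq (u j) 0) => [->|/xr ->]; rewrite ?mul0r ?mulr0 //; ring.
    move=> /eqP; rewrite mulf_eq0 => /orP[/eqP //|/eqP s0].
    have := sum_ge0_eq0 (fun j => mulr_ge0 (u0 j) (ltW (w0 j))) s0 i0.
    by move=> /eqP; rewrite mulf_eq0 (negbTE ui0) gt_eqF.
  move=> i; case: (eqVneq (u i) 0) => [/xoff //|/xr ->].
  by rewrite xi0 mul0r.
(* The Perron vector satisfies [A w' = D w' = u]; pairing [L z = D y] with it leaves a positive
   multiple of the sum of [u i * z i], which must vanish. *)
pose w' i := if u i == 0 then 0 else w i.
have w'D i : w' i * D i = u i.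
  rewrite /w' /D; case: eqP => [->|_]; first by rewrite mul0r.
  by rewrite mulrC divfK ?gt_eqF.
have uz : \sum_i u i * z i = 0.
  have : \sum_i w' i * (\sum_j L i j * z j) = 0.
    by apply: etrans uy; apply: eq_bigr => i _; rewrite zP mulrA w'D.
  under eq_bigr => i _ do rewrite LE mulrDr mulrBr !mulrA w'D.
  rewrite big_split sumrB /=.
  have -> : \sum_i w' i * (\sum_j A i j * z j) = \sum_j u j * z j.
    under eq_bigr => i _ do rewrite mulr_sumr.
    rewrite exchange_big; apply: eq_bigr => j _; rewrite mulr_suml.
    apply: eq_bigr => i _; rewrite /w'; case: eqP => [/uA Ai|_].
      by rewrite (sA j) Ai !mul0r.
    by rewrite (sA j); ring.
  rewrite subrr add0r -mulr_suml => /eqP; rewrite mulf_eq0 => /orP[/eqP s0|/eqP //].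
  have pos i : 0 <= w' i * u i.
    by rewrite /w'; case: eqP; rewrite ?mul0r // => _; rewrite mulr_ge0 // ltW.
  have := sum_ge0_eq0 pos s0 i0; rewrite /w' (negbTE ui0) => /eqP.
  by rewrite mulf_eq0 (negbTE ui0) gt_eqF.
have Az i : \sum_j A i j * z j = D i * (z i - y i).
  by have := zP i; rewrite LE uz mulr0 addr0 mulrBr => <-; ring.
have zAz : bform A z z = \sum_i D i * (z i * (z i - y i)).
  by rewrite bAE; apply: eq_bigr => i _; rewrite Az; ring.
have yAz : bform A y z = \sum_i D i * (y i * (z i - y i)).
  by rewrite bAE; apply: eq_bigr => i _; rewrite Az; ring.
have leE (a b : R) : a = b -> a <= b by move=> ->.
(* Since [A z = D (z - y)], the hypothesis [hA] at [z] compares [z D (z - y)] with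
   [(z - y) D (z - y)]; their difference is the claim. *)
have qp : \sum_i D i * (y i * (z i - y i)) <= 0.
  have : bform A z z <= \sum_i D i * (z i - y i) ^+ 2.
    apply: le_trans (hA z) _; apply: ler_sum => i _; rewrite Az -/(u i).
    rewrite exprMn /D; case: eqP => [->|/eqP ui].
      by rewrite invr0 mulr0 mul1r sqr_ge0.
    apply: leE; field; by rewrite ui gt_eqF.
  rewrite zAz -subr_ge0 -sumrB => h; rewrite -oppr_ge0 -sumrN.
  apply: le_trans h _; apply: ler_sum => i _.
  by apply: leE; ring.
(* At [y - z], the inequality [A <= D] reduces to [y A y <= y D (z - y)], which is nonpositive by
   [qp]. *)
have := DA (fun i => 1 * y i + (-1) * z i).
rewrite bformDl !bformDr (bformC z y sA) zAz yAz.
have -> : \sum_i D i * (1 * y i + -1 * z i) ^+ 2 =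
   \sum_i D i * (z i * (z i - y i)) - \sum_i D i * (y i * (z i - y i)).
  by rewrite -sumrB; apply: eq_bigr => i _; ring.
by move: qp; lra.
Qed.

(** By symmetry of [T], the [k]-th entries of [A x] and [A w] are [T_k(x, w)] and [T_k(w, w)].
    Reverse Cauchy-Schwarz for each slice at [x] and [w], summed with weights [w k], is the
    hypothesis of [lor_of_le_square]. If [T_k(w, w) = 0], nonnegativity makes the slice vanish. *)
Lemma lor_contract (T : K -> K -> K -> R) w :
  (forall i j k, T i j k = T j i k) -> (forall i j k, T i j k = T i k j) ->
  (forall i j k, 0 <= T i j k) -> (forall i, 0 < w i) ->
  (forall i j, i != j -> \sum_k w k * T k i j = 0 ->
     (forall l, \sum_k w k * T k i l = 0) \/ (forall l, \sum_k w k * T k j l = 0)) ->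
  (forall k, lor (T k)) -> lor (fun i j => \sum_k w k * T k i j).
Proof.
move=> s1 s2 T0 w0 cT lT.
have AE k x : \sum_j (\sum_l w l * T l k j) * x j = bform (T k) x w.
  apply: eq_bigr => i _; rewrite mulr_suml; apply: eq_bigr => l _.
  by rewrite (s1 l) (s2 k l); ring.
apply: (lor_of_le_square (w := w)) => //.
- by move=> i j; apply: eq_bigr => k _; rewrite s2.
- by move=> i j; apply: sumr_ge0 => k _; rewrite mulr_ge0 // ltW.
move=> x.
have -> : bform (fun i j => \sum_k w k * T k i j) x x = \sum_k w k * bform (T k) x x.
  under [RHS]eq_bigr => k _ do rewrite mulr_sumr.
  rewrite [RHS]exchange_big; apply: eq_bigr => i _.
  under [RHS]eq_bigr => k _ do rewrite mulr_sumr.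
  rewrite [RHS]exchange_big; apply: eq_bigr => j _ /=.
  by rewrite mulr_sumr mulr_suml; apply: eq_bigr => k _; ring.
apply: ler_sum => k _; rewrite !AE -mulrA ler_wpM2l //; first exact: ltW.
have t0 i j : 0 <= w i * T k i j * w j.
  by rewrite !mulr_ge0 //; exact: ltW.
have : 0 <= bform (T k) w w.
  by apply: sumr_ge0 => i _; exact: sumr_ge0.
rewrite le_eqVlt => /orP[/eqP b0|b0]; last by rewrite ler_pdivlMr //; exact: lT.
rewrite -b0 invr0 mulr0 /bform big1 // => i _; rewrite big1 // => j _.
have bi : \sum_j w i * T k i j * w j = 0.
  by apply: (sum_ge0_eq0 _ (esym b0) i) => i'; apply: sumr_ge0.
have /eqP := sum_ge0_eq0 (t0 i) bi j.
by rewrite !mulf_eq0 !(gt_eqF (w0 _)) orbF /= => /eqP ->; rewrite mulr0 mul0r.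
Qed.

End ReverseCauchySchwarz.

Lemma lor_pullback (R : realFieldType) (K K' : finType) (A : K -> K -> R)
    (B : K' -> K -> R) :
  lor A -> lor (fun i j => \sum_k \sum_l B i k * A k l * B j l).
Proof.
move=> lA x y.
have bE x' y' : bform (fun i j => \sum_k \sum_l B i k * A k l * B j l) x' y' =
    bform A (fun k => \sum_i B i k * x' i) (fun k => \sum_i B i k * y' i).
  transitivity (\sum_i \sum_j \sum_k \sum_l B i k * x' i * A k l * (B j l * y' j)).
    apply: eq_bigr => i _; apply: eq_bigr => j _.
    rewrite mulr_sumr mulr_suml; apply: eq_bigr => k _.
    by rewrite mulr_sumr mulr_suml; apply: eq_bigr => l _; ring.
  under eq_bigr => i _ do rewrite exchange_big.
  rewrite exchange_big; apply: eq_bigr => k _ /=.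
  under eq_bigr => i _ do rewrite exchange_big.
  rewrite exchange_big; apply: eq_bigr => l _ /=.
  rewrite !mulr_suml; apply: eq_bigr => i _; rewrite mulr_sumr.
  by apply: eq_bigr => j _.
by rewrite !bE; exact: lA.
Qed.

(** * Symmetric tensors, directional derivatives and linear substitutions *)

Section Tensors.
Variables (R : realFieldType) (K : finType).
Implicit Types (c : seq K -> R) (v : K -> R) (vs : seq (K -> R)).

(* A symmetric function on words [c] stands for the polynomial whose coefficient at
   a monomial listed by [I] is [c I] divided by the product of the factorials of the
   exponents; [contr v] is then the derivative in the direction [v]. *)
Definition symf c := forall I J, perm_eq I J -> c I = c J.

Definition contr v c : seq K -> R := fun I => \sum_k v k * c (k :: I).

Definition contrs vs c : seq K -> R := foldl (fun c v => contr v c) c vs.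

Lemma contr_ext v c c' : c =1 c' -> contr v c =1 contr v c'.
Proof. by move=> e I; apply: eq_bigr => k _; rewrite e. Qed.

Lemma contrs_ext vs c c' : c =1 c' -> contrs vs c =1 contrs vs c'.
Proof.
by elim: vs c c' => //= v vs IH c c' e; apply: IH; apply: contr_ext.
Qed.

Lemma contr_sym v c : symf c -> symf (contr v c).
Proof.
move=> sc I J IJ; apply: eq_bigr => k _; congr (_ * _); apply: sc.
by rewrite perm_cons.
Qed.

Lemma contrC u v c : symf c -> contr u (contr v c) =1 contr v (contr u c).
Proof.
move=> sc I; rewrite /contr.
under eq_bigr => k _ do rewrite mulr_sumr.
under [RHS]eq_bigr => k _ do rewrite mulr_sumr.
rewrite exchange_big; apply: eq_bigr => k _; apply: eq_bigr => l _.
rewrite (sc (k :: l :: I) (l :: k :: I)); first by ring.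
exact/permP/(fun a => addnCA _ _ _).
Qed.

Lemma contrs_contr vs v c : symf c -> contrs vs (contr v c) =1 contr v (contrs vs c).
Proof.
elim: vs c => //= u vs IH c sc I.
rewrite -(IH _ (contr_sym u sc)); apply: contrs_ext.
by move=> J; apply: contrC.
Qed.

Lemma contrsC vs ws c : symf c -> contrs (vs ++ ws) c =1 contrs (ws ++ vs) c.
Proof.
rewrite /contrs !foldl_cat -!/(contrs _ _).
elim: vs c => //= v vs IH c sc I.
rewrite IH; last exact: contr_sym.
by apply: contrs_ext => J; apply: contrs_contr.
Qed.

End Tensors.

Section Pull.
Variables (R : realFieldType) (K K' : finType) (B : K' -> K -> R).

(** If [c] encodes a form [f], this encodes [f (sum_i x_i B_i)] as a polynomial in [x]: its partial
    derivative in [x_i] is the derivative of [f] in the direction [B i]. *)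
Definition pull (c : seq K -> R) (I : seq K') : R := contrs (map B I) c [::].

Lemma pull_sym c : symf c -> symf (pull c).
Proof.
move=> sc I J; apply: catCA_perm_subst => s1 s2 s3; rewrite /pull !catA !map_cat.
rewrite /contrs !(foldl_cat _ _ _ (map B s3)) -!/(contrs _ _).
by apply: contrs_ext => L; apply: contrsC.
Qed.

End Pull.

(** * Polynomials multiaffine in all variables but one, under positive substitutions *)

Section Multiaffine.
Variables (R : realFieldType) (T : finType).
Implicit Types (c : seq (option T) -> R) (I : seq (option T)).

Definition mult_free I := uniq (pmap id I).

Lemma mult_freeS e I : mult_free (Some e :: I) = (e \notin pmap id I) && mult_free I.
Proof. by []. Qed.

Lemma mult_freeN I : mult_free (None :: I) = mult_free I.
Proof. by []. Qed.

Lemma mult_free_behead k I : mult_free (k :: I) -> mult_free I.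
Proof. by case: k => [e|] //; rewrite mult_freeS => /andP[]. Qed.

Lemma mult_free_perm I J : perm_eq I J -> mult_free I = mult_free J.
Proof. by move=> IJ; apply: perm_uniq; apply: perm_pmap. Qed.

Lemma mult_free_pair i j I : i != j ->
  mult_free (i :: I) -> mult_free (j :: I) -> mult_free (i :: j :: I).
Proof.
case: i => [e|]; case: j => [f|] //.
by rewrite !mult_freeS /= inE negb_or => ef /andP[-> ->] /andP[-> _]; rewrite !andbT.
Qed.

(** [s] is the degree and [None] the homogenising variable, the only one that may repeat. Requiring
    every multiaffine coefficient to be positive supplies the connectedness needed to differentiate
    in positive directions. *)
Definition lor_multiaffine (s : nat) (c : seq (option T) -> R) :=
  [/\ symf c,
      (forall I, size I = s -> mult_free I -> 0 < c I),
      (forall I, size I = s -> ~~ mult_free I -> c I = 0) &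
      (forall I, (size I + 2)%N = s -> lor (fun i j => c (i :: j :: I)))].

(** An instance of [lor_contract]. For distinct [i] and [j], either one of them repeats an element
    of [I], and its row vanishes, or the word [None, i, j, I] has a positive coefficient and so does
    the entry at [i], [j]. *)
Lemma contr_lor_multiaffine s v c : (forall k, 0 < v k) ->
  lor_multiaffine s.+3 c -> lor_multiaffine s.+2 (contr v c).
Proof.
move=> v0 [sc c1 c0 lc].
have c_ge0 I : size I = s.+3 -> 0 <= c I.
  by move=> sI; case: (boolP (mult_free I)) => [/(c1 _ sI)/ltW|/(c0 _ sI) ->].
split; first exact: contr_sym.
- move=> I sI fI; rewrite /contr (bigD1 None) //=.
  rewrite ltr_wpDr //; last by rewrite mulr_gt0 // c1 //= sI.
  by apply: sumr_ge0 => k _; rewrite mulr_ge0 ?c_ge0 //= ?sI // ltW.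
- move=> I sI fI; rewrite /contr big1 // => k _; rewrite c0 ?mulr0 //= ?sI //.
  by apply: contra fI; apply: mult_free_behead.
move=> I; rewrite addn2 => -[sI].
have swap01 i j J : c (i :: j :: J) = c (j :: i :: J).
  exact/sc/permP/(fun a => addnCA _ _ _).
have swap12 i j k J : c (i :: j :: k :: J) = c (i :: k :: j :: J).
  by apply: sc; rewrite perm_cons; exact/permP/(fun a => addnCA _ _ _).
have row0 j : ~~ mult_free (j :: I) -> forall l, \sum_k v k * c (k :: j :: l :: I) = 0.
  move=> fj l; rewrite big1 // => k _; rewrite c0 ?mulr0 //= ?sI //.
  apply: contra fj => fkl; apply: (@mult_free_behead k); apply: (@mult_free_behead l).
  by rewrite -(@mult_free_perm [:: k, j, l & I]) // (perm_catCA [:: k; j] [:: l] I).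
apply: (lor_contract (T := fun k i j => c [:: k, i, j & I])) => //.
- by move=> i j k; rewrite c_ge0 //= sI.
- move=> i j ij /sum_ge0_eq0 s0.
  case: (boolP (mult_free (i :: I))) => fi; last by left; apply: row0.
  case: (boolP (mult_free (j :: I))) => fj; last by right; apply: row0.
  have /eqP : v None * c [:: None, i, j & I] = 0.
    by apply: s0 => k; rewrite mulr_ge0 ?c_ge0 //= ?sI // ltW.
  have cN : 0 < c [:: None, i, j & I].
    by apply: c1; rewrite /= ?sI // mult_freeN; apply: mult_free_pair.
  by rewrite mulf_eq0 (gt_eqF (v0 _)) (gt_eqF cN).
move=> k; apply: eq_lor _ (lc (k :: I) _) => [i j|]; last by rewrite /= sI addn2.
by rewrite (swap12 i j k) (swap01 i k).
Qed.

Lemma contrs_lor_multiaffine vs s c : (forall v, List.In v vs -> forall k, 0 < v k) ->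
  lor_multiaffine (size vs + s).+2 c -> lor_multiaffine s.+2 (contrs vs c).
Proof.
elim: vs c => //= v vs IH c v0 lc; apply: IH => [u uv|]; first by apply: v0; right.
by apply: contr_lor_multiaffine => //; apply: v0; left.
Qed.

Section PullPositive.
Variables (K' : finType) (B : K' -> option T -> R).
Hypothesis B0 : forall i k, 0 < B i k.

Lemma map_pos (I : seq K') v : List.In v (map B I) -> forall k, 0 < v k.
Proof. by elim: I => //= i I IH [<- //|/IH]. Qed.

Lemma pull_cat2 (I : seq K') i j c :
  pull B c (I ++ [:: i; j]) =
  \sum_k \sum_l B i k * contrs (map B I) c [:: k; l] * B j l.
Proof.
rewrite /pull map_cat /contrs foldl_cat /= exchange_big /=; apply: eq_bigr => l _.
by rewrite mulr_sumr; apply: eq_bigr => k _; ring.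
Qed.

(** After contracting all but two letters, the entry at [None, None] is positive, and no other entry
    is negative. *)
Lemma pull_gt0 s c (I : seq K') : lor_multiaffine s.+2 c -> size I = s.+2 ->
  0 < pull B c I.
Proof.
move=> lc; case/lastP: I => // I j; case/lastP: I => // I i; rewrite !size_rcons.
move=> -[sI]; rewrite -!cats1 -catA pull_cat2.
have [||_ c1 c0 _] := @contrs_lor_multiaffine (map B I) 0 c; first exact: map_pos.
  by rewrite size_map addn0 sI.
have c_ge0 J : size J = 2 -> 0 <= contrs (map B I) c J.
  by move=> sJ; case: (boolP (mult_free J)) => [/(c1 _ sJ)/ltW|/(c0 _ sJ) ->].
have p0 k l : 0 <= B i k * contrs (map B I) c [:: k; l] * B j l.
  by rewrite !mulr_ge0 ?c_ge0 // ltW.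
rewrite (bigD1 None) //= ltr_wpDr //.
  by apply: sumr_ge0 => k _; apply: sumr_ge0.
rewrite (bigD1 None) //= ltr_wpDr //; first by apply: sumr_ge0.
by rewrite !mulr_gt0 // c1.
Qed.

(** Contracting along [I] leaves a quadratic form; the two remaining letters substitute linear forms
    into it. *)
Lemma pull_lor s c (I : seq K') : lor_multiaffine s.+2 c -> size I = s ->
  lor (fun i j => pull B c [:: i, j & I]).
Proof.
move=> lc sI; have [sc _ _ _] := lc.
have [||_ _ _ lI] := @contrs_lor_multiaffine (map B I) 0 c; first exact: map_pos.
  by rewrite size_map addn0 sI.
apply: eq_lor _ (lor_pullback (B := B) (lI [::] erefl)) => i j; rewrite -pull_cat2.
by apply: (pull_sym B sc); rewrite perm_catC.
Qed.

End PullPositive.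

End Multiaffine.

(** * Matroid rank, nullity, and parallel classes of a contraction *)

Section Matroid.
Local Open Scope nat_scope.
Variables (T : finType) (Bs : {set {set T}}).
Hypothesis BsM : matroid_bases Bs.
Implicit Types (X Y I J : {set T}) (e f g : T).

Definition mindep I := [exists B in Bs, I \subset B].

Definition mrank X := \max_(B in Bs) #|X :&: B|.

Definition mnull X := #|X| - mrank X.

Lemma mindepP I : reflect (exists2 B, B \in Bs & I \subset B) (mindep I).
Proof. exact: exists_inP. Qed.

Lemma mindep_sub I J : I \subset J -> mindep J -> mindep I.
Proof.
by move=> IJ /mindepP[B BB JB]; apply/mindepP; exists B => //; apply: subset_trans JB.
Qed.

Lemma card_exchange (B : {set T}) x y : x \in B -> y \notin B -> #|y |: (B :\ x)| = #|B|.
Proof.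
move=> xB yB; rewrite cardsU1 in_setD1 negb_and yB orbT.
by rewrite (cardsD1 x B) xB.
Qed.

Lemma setD_exchange (B1 B2 : {set T}) x y : y \in B2 :\: B1 ->
  (y |: (B1 :\ x)) :\: B2 = (B1 :\: B2) :\ x.
Proof.
rewrite inE => /andP[yB1 yB2]; apply/setP => z; rewrite !inE.
case: (eqVneq z y) => [->|_] /=; first by rewrite yB2 (negbTE yB1) !andbF.
by rewrite andbCA.
Qed.

Lemma card_basis B1 B2 : B1 \in Bs -> B2 \in Bs -> #|B1| = #|B2|.
Proof.
suff le B B' : B \in Bs -> B' \in Bs -> #|B| <= #|B'|.
  by move=> h1 h2; apply/eqP; rewrite eqn_leq !le.
have [_ ex] := BsM; move=> + B'B.
have [k] := ubnP #|B :\: B'|; elim: k B => // k IH B hk BB.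
case: (set_0Vmem (B :\: B')) => [/eqP|[x xB]].
  by rewrite setD_eq0 => /subset_leq_card.
have [y yB yBs] := ex _ _ BB B'B x xB.
have [xB1 _] : x \in B /\ x \notin B' by move: xB; rewrite inE => /andP[].
have yB1 : y \notin B by move: yB; rewrite inE => /andP[].
rewrite -(card_exchange xB1 yB1); apply: IH => //.
by rewrite setD_exchange //; move: hk; rewrite (cardsD1 x (B :\: B')) xB.
Qed.

(** Take a basis [B1] containing [I] that meets a basis [B2] containing [J] in as many elements as
    possible. By exchange [B1 :\: B2] lies in [I]; if no augmentation exists, [J :&: B1] lies in [I]
    too. Then [#|J :\: I| <= #|B2 :\: B1| = #|B1 :\: B2| <= #|I :\: J|], a contradiction. *)
Lemma mindep_augment I J : mindep I -> mindep J -> #|I| < #|J| ->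
  exists2 x, x \in J :\: I & mindep (x |: I).
Proof.
move=> /mindepP[B1' B1'B IB1'] /mindepP[B2 B2B JB2] ltIJ.
case: (pickP [pred x in J :\: I | mindep (x |: I)]) => [x /andP[]|no]; first by exists x.
have [B1 /andP[B1B IB1] maxB] :=
  @arg_maxnP _ B1' [pred B in Bs | I \subset B] (fun B => #|B :&: B2|)
    (introT andP (conj B1'B IB1')).
have JB1 : J :&: B1 \subset I.
  apply/subsetP => x /setIP[xJ xB]; apply/negPn/negP => xI.
  have /negP[] := negbT (no x); rewrite /= inE xI xJ /=.
  by apply/mindepP; exists B1 => //; rewrite subUset sub1set xB.
have B1B2I : B1 :\: B2 \subset I.
  apply/subsetP => x xB; apply/negPn/negP => xI.
  have [y yB yBs] := BsM.2 _ _ B1B B2B x xB.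
  have IB' : I \subset y |: (B1 :\ x).
    apply/subsetP => z zI; rewrite !inE (subsetP IB1) // andbT orbC.
    by case: eqP => // zx; rewrite -zx zI in xI.
  have := maxB (y |: (B1 :\ x)) (introT andP (conj yBs IB')).
  apply/negP; rewrite -ltnNge; apply: proper_card; apply/properP; split.
    apply/subsetP => z /setIP[zB zB2]; rewrite !inE zB zB2 !andbT.
    rewrite orbC; case: eqP => // zx; by move: xB; rewrite -zx inE zB2.
  by move: yB; rewrite !inE => /andP[y1 y2]; exists y; rewrite !inE ?eqxx ?y2 ?(negbTE y1).
have h1 : #|J :\: I| <= #|B2 :\: B1|.
  apply/subset_leq_card/subsetP => x /setDP[xJ xI]; rewrite inE (subsetP JB2) // andbT.
  by apply: contra xI => xB; apply: (subsetP JB1); rewrite inE xJ.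
have h2 : #|B1 :\: B2| <= #|I :\: J|.
  apply/subset_leq_card/subsetP => x xB; rewrite inE (subsetP B1B2I) // andbT.
  by apply: contraL xB => /(subsetP JB2) xB2; rewrite inE xB2.
have := card_basis B1B B2B; have := cardsID B2 B1; have := cardsID B1 B2.
have := cardsID J I; have := cardsID I J; rewrite (setIC J I) (setIC B2 B1).
by lia.
Qed.

Lemma leq_mrank X B : B \in Bs -> #|X :&: B| <= mrank X.
Proof. by move=> BB; apply: (@leq_bigmax_cond _ (mem Bs) (fun B => #|X :&: B|)). Qed.

Lemma mrank_indep X I : mindep I -> I \subset X -> #|I| <= mrank X.
Proof.
move=> /mindepP[B BB IB] IX; apply: leq_trans (leq_mrank X BB).
by apply: subset_leq_card; rewrite subsetI IX.
Qed.

Lemma mrank_witness X : exists I, [/\ mindep I, I \subset X & #|I| = mrank X].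
Proof.
have /card_gt0P[B0 B0B] : 0 < #|Bs| by rewrite card_gt0; case: BsM.
have [B BB eB] := eq_bigmax_cond (fun B => #|X :&: B|)
  (introT (@card_gt0P _ (mem Bs)) (ex_intro _ B0 B0B)).
have {}eB : mrank X = #|X :&: B| by [].
rewrite eB; exists (X :&: B); rewrite subsetIl; split=> //.
by apply/mindepP; exists B => //; apply: subsetIr.
Qed.

Lemma mrank_extend X I : mindep I -> I \subset X ->
  exists J, [/\ mindep J, I \subset J, J \subset X & #|J| = mrank X].
Proof.
have [k] := ubnP (mrank X - #|I|); elim: k I => // k IH I hk iI IX.
have := mrank_indep iI IX; rewrite leq_eqVlt => /orP[/eqP e|lt]; first by exists I.
have [J [iJ JX cJ]] := mrank_witness X; rewrite -cJ in lt.
have [x /setDP[xJ xI] ix] := mindep_augment iI iJ lt.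
have [||J' [iJ' IJ' JX' cJ']] := IH (x |: I) _ ix.
- by rewrite cardsU1 xI; move: hk lt; rewrite cJ; lia.
- by rewrite subUset sub1set (subsetP JX) // IX.
by exists J'; split=> //; apply: subset_trans IJ'; apply: subsetUr.
Qed.

Lemma mrank_card X : mrank X <= #|X|.
Proof. by apply/bigmax_leqP => B _; apply/subset_leq_card/subsetIl. Qed.

Lemma mrankS X Y : X \subset Y -> mrank X <= mrank Y.
Proof.
move=> XY; have [I [iI IX <-]] := mrank_witness X.
by apply: mrank_indep => //; apply: subset_trans XY.
Qed.

Lemma mrankU1 e X : mrank (e |: X) <= (mrank X).+1.
Proof.
have [I [iI IX <-]] := mrank_witness (e |: X).
rewrite (cardsD1 e I); apply: (leq_add (leq_b1 _)); apply: mrank_indep.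
  by apply: mindep_sub iI; apply: subD1set.
by rewrite subDset.
Qed.

(** Extend a maximal independent subset [I] of [X] through [f |: X] to [e |: (f |: X)]. If the last
    step raised the rank, it would add [e], and [e |: I] would be too large an independent subset of
    [e |: X]. *)
Lemma mrank_submod e f X : mrank (e |: X) = mrank X ->
  mrank (e |: (f |: X)) = mrank (f |: X).
Proof.
move=> re; have [eX|eX] := boolP (e \in X).
  by rewrite (setUidPr _) // sub1set inE eX orbT.
apply/eqP; rewrite eqn_leq andbC mrankS ?subsetUr //= leqNgt; apply/negP => lt.
have [I [iI IX cI]] := mrank_witness X.
have [I1 [iI1 II1 I1X cI1]] := mrank_extend iI (subset_trans IX (subsetUr [set f] X)).
have [I2 [iI2 I12 I2X cI2]] :=
  mrank_extend iI1 (subset_trans I1X (subsetUr [set e] (f |: X))).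
have eI2 : e \in I2.
  apply: contraLR lt => eI2; rewrite -leqNgt -cI2; apply: mrank_indep => //.
  apply/subsetP => x xI; have := subsetP I2X x xI; rewrite !inE.
  by case: eqP => // xe; rewrite -xe xI in eI2.
have : #|e |: I| <= mrank (e |: X).
  apply: mrank_indep; last exact: setUS.
  apply: mindep_sub iI2; rewrite subUset sub1set eI2.
  exact: subset_trans I12.
rewrite re -cI cardsU1; have -> : e \notin I by apply: contra eX; apply: (subsetP IX).
by rewrite ltnn.
Qed.

Lemma mnull_eq0 X : (mnull X == 0) = mindep X.
Proof.
rewrite subn_eq0; apply/idP/idP => [|iX]; last exact: mrank_indep.
have [I [iI IX <-]] := mrank_witness X.
by move=> /(conj IX)/andP; rewrite -eqEcard => /eqP <-.
Qed.

Section Parallel.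
Variable X : {set T}.

Definition nonloop e := mrank (e |: X) == (mrank X).+1.

(** Parallelism in the contraction by [X], with every loop put in a class of its own so that this is
    an equivalence relation. *)
Definition parallel e f := (e == f) ||
  [&& nonloop e, nonloop f & mrank (e |: (f |: X)) == (mrank X).+1].

Lemma parallel_sym e f : parallel e f = parallel f e.
Proof. by rewrite /parallel eq_sym setUCA andbCA. Qed.

Lemma parallel_trans : transitive parallel.
Proof.
move=> f e g; rewrite /parallel.
case: (eqVneq e f) => [-> //|_] /=; case: (eqVneq f g) => [<- -> //|_] /=.
  by rewrite orbT.
move=> /and3P[ne nf /eqP ref] /and3P[_ ng /eqP rfg]; rewrite ne ng /=.
apply/orP; right; rewrite eqn_leq; apply/andP; split.
  have refg : mrank (e |: (g |: (f |: X))) = mrank (g |: (f |: X)).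
    by apply: mrank_submod; rewrite ref; apply/esym/eqP.
  rewrite -rfg (setUCA [set f]) -refg; apply/mrankS/setUS/setUS/subsetUr.
by rewrite -(eqP ne); apply/mrankS/setUS/subsetUr.
Qed.

Lemma mnullU1 e : e \notin X -> mnull (e |: X) = mnull X + ~~ nonloop e.
Proof.
move=> eX; rewrite /mnull /nonloop cardsU1 eX.
have := mrankU1 e X; have := mrankS (subsetUr [set e] X); have := mrank_card X.
by case: eqP => /=; lia.
Qed.

(** The nullity gained splits into one unit per loop and one for a parallel pair; the first two
    become a diagonal rescaling of the Hessian, and only the last couples [e] with [f]. *)
Lemma mnullU2 e f : e \notin X -> f \notin X -> e != f ->
  mnull (e |: (f |: X)) = mnull X + ~~ nonloop e + ~~ nonloop f + parallel e f.
Proof.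
move=> eX fX ef; rewrite /parallel (negbTE ef) /= /mnull !cardsU1.
rewrite !inE negb_or ef eX fX /nonloop.
have := mrankU1 e X; have := mrankS (subsetUr [set e] X); have := mrank_card X.
have := mrankU1 f X; have := mrankS (subsetUr [set f] X).
have := mrankU1 e (f |: X); have := mrankS (subsetUr [set e] (f |: X)).
have := @mrank_submod e f X; have := @mrank_submod f e X; rewrite (setUCA [set f]).
have := mrankS (setUS [set e] (subsetUr [set f] X)).
by case: eqP; case: eqP; case: eqP => /=; lia.
Qed.

End Parallel.

End Matroid.

Lemma big_option (V : nmodType) (T : finType) (F : option T -> V) :
  \sum_i F i = F None + \sum_e F (Some e).
Proof.
rewrite (bigD1 None) //=; congr (_ + _).
rewrite (reindex_omap Some id) /=; last by case.
by apply: eq_bigl => e; rewrite eqxx.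
Qed.

(** * Cauchy-Schwarz over the classes of an equivalence relation *)

Section SumSquares.
Variable R : realFieldType.

Lemma sqr_sum_le (I : finType) (P : {set I}) (F : I -> R) :
  (\sum_(i in P) F i) ^+ 2 <= #|P|%:R * \sum_(i in P) F i ^+ 2.
Proof.
rewrite -subr_ge0.
have -> : #|P|%:R * (\sum_(i in P) F i ^+ 2) - (\sum_(i in P) F i) ^+ 2 =
    \sum_(i in P) \sum_(j in P) 2^-1 * (F i - F j) ^+ 2.
  set S1 := \sum_(i in P) F i; set S2 := \sum_(i in P) F i ^+ 2.
  have inner i : \sum_(j in P) 2^-1 * (F i - F j) ^+ 2 =
      2^-1 * #|P|%:R * F i ^+ 2 + 2^-1 * S2 - F i * S1.
    transitivity (\sum_(j in P) (2^-1 * F i ^+ 2 + 2^-1 * F j ^+ 2 - F i * F j)).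
      by apply: eq_bigr => j _; field.
    by rewrite sumrB big_split /= sumr_const -!mulr_sumr -mulr_natl -/S1 -/S2; ring.
  under eq_bigr => i _ do rewrite inner.
  rewrite sumrB big_split /= sumr_const -mulr_sumr -mulr_suml -/S1 -/S2 -mulr_natl.
  by field.
by apply: sumr_ge0 => i _; apply: sumr_ge0 => j _; rewrite mulr_ge0 ?sqr_ge0 ?invr_ge0.
Qed.

(** The double sum is the sum of the squared class sums, and there are at most [#|U|] classes. *)
Lemma sqr_sum_le_equiv (T : finType) (U : {set T}) (r : rel T) (y : T -> R) :
  reflexive r -> (forall e f, r e f = r f e) -> transitive r ->
  (\sum_(e in U) y e) ^+ 2 <=
    #|U|%:R * \sum_(e in U) \sum_(f in U | r e f) y e * y f.
Proof.
move=> rr rs rt; pose cl e := [set f | r e f].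
have clE e f : r e f = (cl f == cl e).
  apply/idP/eqP => [ref|efe].
    by apply/setP => g; rewrite !inE; apply/idP/idP; apply: rt; rewrite // rs.
  by have : f \in cl f; [rewrite inE|rewrite efe inE].
pose s C := \sum_(e in U | cl e == C) y e.
have -> : \sum_(e in U) y e = \sum_(C in cl @: U) s C by apply: partition_big_imset.
have -> : \sum_(e in U) \sum_(f in U | r e f) y e * y f = \sum_(C in cl @: U) s C ^+ 2.
  rewrite (partition_big_imset cl); apply: eq_bigr => C _.
  rewrite expr2 mulr_suml; apply: eq_bigr => e /andP[_ /eqP <-].
  rewrite mulr_sumr; apply: eq_bigl => f; by rewrite clE.
apply: le_trans (sqr_sum_le _ _) _; apply: ler_wpM2r.
  by apply: sumr_ge0 => C _; apply: sqr_ge0.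
by rewrite ler_nat leq_imset_card.
Qed.

End SumSquares.

(** * Hessians of the multivariate Tutte polynomial *)

Section BaseTensor.
Variables (R : realFieldType) (T : finType) (Bs : {set {set T}}).
Hypothesis BsM : matroid_bases Bs.
Variable q : R.

(* The multivariate Tutte polynomial, with [w_e] rescaled by [q]. *)
Definition tutte_tensor (I : seq (option T)) : R :=
  if mult_free I then
    (count_mem None I)`!%:R * q ^+ mnull Bs [set x in pmap id I]
  else 0.

Lemma tutte_sym : symf tutte_tensor.
Proof.
move=> I J IJ; rewrite /tutte_tensor (mult_free_perm IJ) (permP IJ (pred1 None)).
case: ifP => // _; congr (_ * q ^+ mnull Bs _).
by apply/setP => x; rewrite !inE (perm_mem (perm_pmap id IJ)).
Qed.

Lemma size_mult_free (I : seq (option T)) : mult_free I ->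
  size I = (count_mem None I + #|[set x in pmap id I]|)%N.
Proof.
move=> fI; rewrite cardsE (card_uniqP fI).
rewrite size_pmap -(count_predC (pred1 None) I); congr (_ + _)%N.
by apply: eq_count => -[].
Qed.

Hypotheses (q_gt0 : 0 < q) (q_le1 : q <= 1).

(** Up to the factor [kap] and the rescaling [y e = lam e * x (Some e)], the form is explicit in
    [x None], the sum [Y] of the [y e], the sum [P] over parallel pairs and the sum [S] of squares.
    On the hyperplane [m * x None + Y = 0] it becomes [((1 - q) (Y^2 - m P) + q (Y^2 - m S)) / m],
    and both brackets are nonpositive by Cauchy-Schwarz. *)
Lemma tutte_lor (I : seq (option T)) : (size I + 2)%N = #|T| ->
  lor (fun i j => tutte_tensor [:: i, j & I]).
Proof.
move=> sI; have [fI|fI] := boolP (mult_free I); last first.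
  have t0 i j : tutte_tensor [:: i, j & I] = 0.
    rewrite /tutte_tensor ifN //; apply: contra fI.
    by move=> /mult_free_behead/mult_free_behead.
  move=> x y; rewrite {1}/bform big1 ?ltxx // => i _.
  by rewrite big1 // => j _; rewrite t0 mulr0 mul0r.
pose A := [set x in pmap id I]; pose b := count_mem None I.
have eA e : (e \in pmap id I) = (e \in A) by rewrite inE.
have setA e : [set x in e :: pmap id I] = e |: A.
  by apply/setP => x; rewrite !inE.
have setA2 e f : [set x in [:: e, f & pmap id I]] = e |: (f |: A).
  by apply/setP => x; rewrite !inE.
have mE : #|~: A| = (b + 2)%N.
  have := cardsC A; have := size_mult_free fI.
  by rewrite -/A -/b -sI; lia.
have [m mP] : {m : R | m = (b + 2)%:R} by exists (b + 2)%:R.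
have [phi phiP] : {phi : R | phi = b`!%:R} by exists b`!%:R.
pose lam e : R := if e \in A then 0 else q ^+ ~~ nonloop Bs A e.
have [qn qnP] : {qn : R | qn = q ^+ mnull Bs A} by exists (q ^+ mnull Bs A).
pose kap : R := phi * qn.
have kap0 : 0 < kap by rewrite mulr_gt0 ?qnP ?exprn_gt0 // phiP ltr0n fact_gt0.
have b1 : b%:R + 1 = m - 1 :> R by rewrite mP natrD; ring.
have f1 : b.+1`!%:R = (m - 1) * phi by rewrite factS natrM -b1 natr1 phiP.
have f2 : b.+2`!%:R = m * ((m - 1) * phi).
  by rewrite factS natrM f1 mP addn2.
have tNN : tutte_tensor [:: None, None & I] = kap * (m * (m - 1)).
  by rewrite /tutte_tensor /= !mult_freeN fI -/A -/b !add1n f2 -qnP /kap; ring.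
have tNS e : tutte_tensor [:: None, Some e & I] = kap * ((m - 1) * lam e).
  rewrite /tutte_tensor /= mult_freeN mult_freeS eA /lam.
  have [eA'|eA'] /= := boolP (e \in A); first by rewrite !mulr0.
  rewrite fI setA mnullU1 // add0n -/b add1n f1 /kap exprD -qnP.
  by move: (q ^+ _) => a; ring.
have tSN e : tutte_tensor [:: Some e, None & I] = kap * ((m - 1) * lam e).
  by rewrite -tNS; apply: tutte_sym; exact/permP/(fun a => addnCA _ _ _).
(* The factor [q] of a parallel pair is written [1 - (1 - q)]; the term in [e == f] makes the
   diagonal vanish, since [parallel] is reflexive. *)
have tSS e f : tutte_tensor [:: Some e, Some f & I] =
   kap * (lam e * lam f * (1 - (1 - q) * (parallel Bs A e f)%:R - q * (e == f)%:R)).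
  rewrite /tutte_tensor /= !mult_freeS /= inE eA /lam.
  have [->|ef] := eqVneq e f; first by rewrite /= /parallel !eqxx /=; ring.
  have [eA'|eA'] /= := boolP (e \in A); first by rewrite !mul0r mulr0.
  rewrite eA; have [fA'|fA'] /= := boolP (f \in A); first by rewrite mulr0 mul0r mulr0.
  rewrite fI setA2 mnullU2 // !add0n -/b -phiP !exprD /kap.
  rewrite -qnP; move: (q ^+ ~~ _) (q ^+ ~~ _) => a a'.
  by case: (parallel Bs A e f); rewrite /= ?expr1 ?expr0; ring.
(* This functional is proportional to the [None] row of the form. *)
apply: (lor_of_hyperplane (l := fun i => if i is Some e then lam e else m)).
  by move=> i j; apply: tutte_sym; exact/permP/(fun a => addnCA _ _ _).
move=> x; rewrite big_option /=; pose y e := lam e * x (Some e).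
set Y := \sum_e y e => lx.
have m0 : 0 < m by rewrite mP ltr0n addn2.
have y0 e : e \in A -> y e = 0 by rewrite /y /lam => ->; rewrite mul0r.
have yA (r : pred T) F : (forall e, e \in A -> F e = 0) ->
    \sum_(e | r e) F e = \sum_(e in ~: A | r e) F e :> R.
  move=> F0; rewrite (bigID (mem A)) /= big1 ?add0r => [|e /andP[_ /F0 //]].
  by apply: eq_bigl => e; rewrite in_setC andbC.
have -> : bform (fun i j => tutte_tensor [:: i, j & I]) x x = kap *
   (m * (m - 1) * x None ^+ 2 + 2 * (m - 1) * x None * Y +
    (Y ^+ 2 - (1 - q) * \sum_e \sum_(f | parallel Bs A e f) y e * y f
     - q * \sum_e y e ^+ 2)).
  rewrite /bform big_option big_option /= tNN.
  under eq_bigr => e _ do rewrite tNS.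
  under [X in _ + X]eq_bigr => e _ do rewrite big_option tSN.
  rewrite big_split /=.
  have -> : \sum_e x None * (kap * ((m - 1) * lam e)) * x (Some e) =
      kap * ((m - 1) * x None * Y).
    by rewrite !mulr_sumr; apply: eq_bigr => e _; rewrite /y; ring.
  have -> : \sum_e x (Some e) * (kap * ((m - 1) * lam e)) * x None =
      kap * ((m - 1) * x None * Y).
    by rewrite !mulr_sumr; apply: eq_bigr => e _; rewrite /y; ring.
  have -> : \sum_e \sum_f x (Some e) * tutte_tensor [:: Some e, Some f & I] * x (Some f)
      = kap * (Y ^+ 2 - (1 - q) * \sum_e \sum_(f | parallel Bs A e f) y e * y f
     - q * \sum_e y e ^+ 2).
    have row e : \sum_f x (Some e) * tutte_tensor [:: Some e, Some f & I] * x (Some f)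
        = kap * (y e * Y - (1 - q) * (\sum_(f | parallel Bs A e f) y e * y f)
                 - q * y e ^+ 2).
      have -> : q * y e ^+ 2 = \sum_f y e * y f * (q * (e == f)%:R).
        rewrite (bigD1 e) //= eqxx big1 ?addr0 /=; first by ring.
        by move=> f; rewrite eq_sym => /negbTE ->; rewrite !mulr0.
      rewrite (big_mkcond (parallel Bs A e)) !mulr_sumr -!sumrB mulr_sumr.
      apply: eq_bigr => f _; rewrite tSS /y.
      by case: (parallel Bs A e f) => /=; ring.
    under eq_bigr => e _ do rewrite row.
    by rewrite -mulr_sumr !sumrB -mulr_suml -!mulr_sumr expr2.
  by ring.
rewrite pmulr_rle0 //.
have -> : x None = - Y / m.
  have mn0 : m != 0 by rewrite gt_eqF.
  apply: (mulfI mn0); rewrite mulrCA divff // mulr1.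
  by apply/eqP; rewrite -addr_eq0 lx.
have h1 : Y ^+ 2 <= m * \sum_e y e ^+ 2.
  rewrite /Y (yA predT) // (yA predT) => [|e /y0 ->]; last by rewrite expr0n.
  by rewrite mP -mE; under eq_bigl do rewrite andbT;
     under [X in _ <= _ * X]eq_bigl do rewrite andbT; apply: sqr_sum_le.
have h2 : Y ^+ 2 <= m * \sum_e \sum_(f | parallel Bs A e f) y e * y f.
  rewrite /Y (yA predT) // (yA predT) => [|e /y0 ye]; last first.
    by rewrite big1 // => f _; rewrite ye mul0r.
  under eq_bigl do rewrite andbT; under [X in _ <= _ * X]eq_bigl do rewrite andbT.
  have inner e : \sum_(f | parallel Bs A e f) y e * y f =
      \sum_(f in ~: A | parallel Bs A e f) y e * y f.
    by apply: (yA (parallel Bs A e)) => f /y0 ->; rewrite mulr0.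
  under [X in _ <= _ * X]eq_bigr => e _ do rewrite inner.
  rewrite mP -mE; apply: sqr_sum_le_equiv.
  - by move=> e; rewrite /parallel eqxx.
  - exact: parallel_sym.
  - exact: parallel_trans.
set P := \sum_e _ in h2 *; set S := \sum_e _ in h1 *.
rewrite -(pmulr_rle0 _ m0).
have -> : m * (m * (m - 1) * (- Y / m) ^+ 2 + 2 * (m - 1) * (- Y / m) * Y +
   (Y ^+ 2 - (1 - q) * P - q * S)) = (1 - q) * (Y ^+ 2 - m * P) + q * (Y ^+ 2 - m * S).
  by field; rewrite gt_eqF.
by rewrite -[leRHS]addr0 lerD // mulr_ge0_le0 ?subr_ge0 ?subr_le0 // ltW.
Qed.

Lemma tutte_lor_multiaffine : lor_multiaffine #|T| tutte_tensor.
Proof.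
split; [exact: tutte_sym| | |exact: tutte_lor].
- move=> I _ fI; rewrite /tutte_tensor fI mulr_gt0 ?exprn_gt0 //.
  by rewrite ltr0n fact_gt0.
- by move=> I _ /negbTE fI; rewrite /tutte_tensor fI.
Qed.

End BaseTensor.

(** * Eigenvalues of a real symmetric matrix of Lorentzian signature *)

Section Spectrum.
Local Open Scope sesquilinear_scope.
Local Notation re := (@complex.Re _).
Local Notation im := (@complex.Im _).
Variables (R : realType) (k : nat) (A : 'M[R]_k).
Hypothesis A_sym : forall i j, A i j = A j i.

Let C := R[i].
Let toC : R -> C := real_complex R.
Let Ac : 'M[C]_k := map_mx toC A.

Lemma sym_spectral : exists (lam : 'I_k -> R) (P : 'M[C]_k),
  P *m P^t* = 1%:M /\ Ac = P^t* *m diag_mx (\row_i toC (lam i)) *m P.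
Proof.
have hA : Ac \is hermsymmx.
  apply/is_hermitianmxP; rewrite expr0 scale1r; apply/matrixP => i j.
  by rewrite !mxE A_sym; apply/esym/conjc_real.
have [+ realD uP] := And3 (hermitian_normalmx hA) (hermitian_spectral_diag_real hA)
  (spectral_unitarymx Ac).
move=> /orthomx_spectralP; rewrite invmx_unitary // => eA.
exists (fun i => re (spectral_diag Ac 0 i)), (spectralmx Ac); split.
  exact/unitarymxP.
suff -> : \row_i toC (re (spectral_diag Ac 0 i)) = spectral_diag Ac by exact: eA.
apply/rowP => i; rewrite mxE /toC RRe_real //; exact: (mxOverP realD).
Qed.

Variables (lam : 'I_k -> R) (P : 'M[C]_k).
Hypotheses (uP : P *m P^t* = 1%:M)
  (eA : Ac = P^t* *m diag_mx (\row_i toC (lam i)) *m P).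

Lemma char_poly_spectral : char_poly A = \prod_i ('X - (lam i)%:P).
Proof.
apply: (map_poly_inj toC); rewrite map_char_poly rmorph_prod /= -/Ac.
have uP' : P^t* *m P = 1%:M by apply: mulmx1C.
transitivity (char_poly (diag_mx (\row_i toC (lam i)))); last first.
  rewrite char_poly_trig ?diag_mx_is_trig //; apply: eq_bigr => i _.
  by rewrite rmorphB /= map_polyX map_polyC !mxE eqxx.
rewrite /char_poly /char_poly_mx {1}eA !map_mxM /=.
set D := diag_mx _; set Q := map_mx polyC P; set Q' := map_mx polyC _.
have QQ : Q' *m Q = 1%:M by rewrite -map_mxM uP' map_mx1.
have -> : 'X%:M - Q' *m map_mx polyC D *m Q = Q' *m ('X%:M - map_mx polyC D) *m Q.
  by rewrite mulmxBr mulmxBl -scalemx1 -scalemxAr -scalemxAl mulmx1 QQ.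
by rewrite !det_mulmx mulrAC -det_mulmx QQ det1 mul1r.
Qed.

Lemma Re_sum (I : finType) (F : I -> C) : re (\sum_i F i) = \sum_i re (F i).
Proof. by apply: (big_morph (@complex.Re R)) => // -[a b] [c d]. Qed.

Lemma Im_sum (I : finType) (F : I -> C) : im (\sum_i F i) = \sum_i im (F i).
Proof. by apply: (big_morph (@complex.Im R)) => // -[a b] [c d]. Qed.

Lemma Re_hermitian_form (z : 'rV[C]_k) :
  re ((z *m Ac *m z^t*) 0 0) =
    bform A (fun i => re (z 0 i)) (fun i => re (z 0 i))
    + bform A (fun i => im (z 0 i)) (fun i => im (z 0 i)).
Proof.
rewrite mxE Re_sum /bform -big_split /=.
under [RHS]eq_bigr => i _ do rewrite -big_split /=.
rewrite [RHS]exchange_big; apply: eq_bigr => j _ /=; rewrite !mxE mulr_suml Re_sum.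
apply: eq_bigr => i _; rewrite !mxE /toC.
by case: (z 0 i) (z 0 j) => [a b] [c d] /=; ring.
Qed.

Lemma Re_spectral_form (c : 'rV[C]_k) :
  re ((c *m P *m Ac *m (c *m P)^t*) 0 0) =
  \sum_i lam i * (re (c 0 i) ^+ 2 + im (c 0 i) ^+ 2).
Proof.
rewrite eA trmx_mul map_mxM !mulmxA mulmxtVK; last exact/unitarymxP.
rewrite -(mulmxA c P) uP mulmx1 mxE Re_sum; apply: eq_bigr => i _.
rewrite mul_mx_diag !mxE /toC.
by case: (c 0 i) => [a b] /=; ring.
Qed.

Variable v : 'I_k -> R.
Hypotheses (v_pos : 0 < bform A v v)
  (v_neg : forall x, (exists i, x i != 0) -> bform A x v = 0 -> bform A x x < 0).

Let vC : 'cV[C]_k := \col_i toC (v i).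

(** The real and imaginary parts of [c *m P] are both orthogonal to [v] for [A] and not both zero,
    so [v_neg] applies to at least one of them. *)
Lemma spectral_form_neg (c : 'rV[C]_k) : c != 0 -> (c *m P *m Ac *m vC) 0 0 = 0 ->
  \sum_i lam i * (re (c 0 i) ^+ 2 + im (c 0 i) ^+ 2) < 0.
Proof.
move=> c0; rewrite -Re_spectral_form Re_hermitian_form.
have : c *m P != 0.
  apply: contra c0 => /eqP cP; apply/eqP.
  by rewrite -[c]mulmx1 -uP mulmxA cP mul0mx.
move: (c *m P) => z z0 zv.
have formE (f : C -> R) : (forall (I : finType) (F : I -> C), f (\sum_i F i) = \sum_i f (F i)) ->
    (forall x a b, f (x * toC a * toC b) = f x * a * b) ->
    f ((z *m Ac *m vC) 0 0) = bform A (fun i => f (z 0 i)) v.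
  move=> fs fM; rewrite mxE fs /bform exchange_big; apply: eq_bigr => j _ /=.
  by rewrite !mxE mulr_suml fs; apply: eq_bigr => i _; rewrite !mxE fM.
have xv : bform A (fun i => re (z 0 i)) v = 0.
  rewrite -formE ?zv //; first exact: Re_sum.
  by move=> [x y] a b; rewrite /toC /=; ring.
have yv : bform A (fun i => im (z 0 i)) v = 0.
  rewrite -formE ?zv //; first exact: Im_sum.
  by move=> [x y] a b; rewrite /toC /=; ring.
have neg x : bform A x v = 0 -> (exists i, x i != 0) \/ bform A x x = 0.
  move=> _; case: (pickP (fun i => x i != 0)) => [i xi|x0]; first by left; exists i.
  right; rewrite /bform big1 // => i _; rewrite big1 // => j _.
  by have /negbFE/eqP -> := x0 i; rewrite !mul0r.
case: (neg _ xv) => [nx|ex]; case: (neg _ yv) => [ny|ey].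
- by rewrite -[ltRHS]addr0 ltrD // v_neg.
- by rewrite ey addr0 v_neg.
- by rewrite ex add0r v_neg.
case/rV0Pn: z0 => i zi; exfalso; move: zi.
have xi0 (f : C -> R) : bform A (fun i => f (z 0 i)) v = 0 ->
  bform A (fun i => f (z 0 i)) (fun i => f (z 0 i)) = 0 -> f (z 0 i) = 0.
  move=> h1 h2; apply/eqP/negPn/negP => fi.
  by have := v_neg (ex_intro _ i fi) h1; rewrite h2 ltxx.
by rewrite eq_complex /= (xi0 _ xv ex) (xi0 _ yv ey) !eqxx.
Qed.

(** Two nonnegative eigenvalues would give a plane of eigenvectors on which the form is nonnegative;
    it contains a nonzero vector [A]-orthogonal to [v], where the form must be negative. *)
Lemma spectrum_unique i j : 0 <= lam i -> 0 <= lam j -> i = j.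
Proof.
move=> li lj; apply/eqP/negPn/negP => ij.
have [W WE] : {W : 'cV[C]_k | W = P *m Ac *m vC} by exists (P *m Ac *m vC).
pose e (l : 'I_k) : 'rV[C]_k := delta_mx 0 l.
have eE (l : 'I_k) : (e l *m W) 0 0 = W l 0 by rewrite /e -rowE mxE.
pose sq (x : C) : R := re x ^+ 2 + im x ^+ 2.
have sq0 x : 0 <= sq x by rewrite addr_ge0 ?sqr_ge0.
have contra_c (c : 'rV[C]_k) : c != 0 -> (c *m W) 0 0 = 0 ->
    (forall l, l != i -> l != j -> c 0 l = 0) -> False.
  move=> c0; rewrite WE !mulmxA => cv cl; have := spectral_form_neg c0 cv.
  apply/negP; rewrite -leNgt; apply: sumr_ge0 => l _.
  case: (eqVneq l i) => [->|li']; first by rewrite mulr_ge0 ?sq0.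
  case: (eqVneq l j) => [->|lj']; first by rewrite mulr_ge0 ?sq0.
  by rewrite cl // /= expr0n addr0 mulr0.
have [wi|wi] := eqVneq (W i 0) 0.
  apply: (contra_c (e i)); rewrite ?eE //.
    by apply/rV0Pn; exists i; rewrite mxE !eqxx oner_eq0.
  by move=> l li' _; rewrite mxE (negbTE li') andbF.
move: (W i 0) (W j 0) wi (eE i) (eE j) => a b a0 ei ej.
apply: (contra_c (b *: e i - a *: e j)).
- apply/rV0Pn; exists j; rewrite !mxE !eqxx [j == i]eq_sym (negbTE ij) /= mulr0.
  by rewrite add0r mulr1 oppr_eq0.
- rewrite mulmxBl -!scalemxAl mxE [X in X + _]mxE [X in _ + X]mxE.
  by rewrite [X in _ - X]mxE ei ej mulrC subrr.
- by move=> l li' lj'; rewrite !mxE (negbTE li') (negbTE lj') !andbF !mulr0 subrr.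
Qed.

(** Without a positive eigenvalue the spectral expansion of the form at [v] would be nonpositive. *)
Lemma spectrum_pos : exists i, 0 < lam i.
Proof.
case: (pickP (fun i => 0 < lam i)) => [i|no]; first by exists i.
have := Re_spectral_form (vC^T *m P^t*).
have zP : vC^T *m P^t* *m P = vC^T.
  by rewrite -mulmxA (mulmx1C uP) mulmx1.
rewrite zP Re_hermitian_form => e; exfalso; move: v_pos; apply/negP; rewrite -leNgt.
have -> : bform A v v =
    bform A (fun i => re (vC^T 0 i)) (fun i => re (vC^T 0 i))
    + bform A (fun i => im (vC^T 0 i)) (fun i => im (vC^T 0 i)).
  rewrite [X in _ + X]/bform [X in _ + X]big1 ?addr0 => [|i _].
    by apply: eq_bform => // i; rewrite !mxE.
  by rewrite big1 // => j _; rewrite !mxE /= !mul0r.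
rewrite e; apply: sumr_le0 => i _; rewrite mulr_le0_ge0 ?addr_ge0 ?sqr_ge0 //.
by rewrite leNgt no.
Qed.

Lemma nondeg_one_pos_spectral : nondeg_one_pos A.
Proof.
have [i0 li0] := spectrum_pos.
have neg i : i != i0 -> lam i < 0.
  move=> ii; rewrite ltNge; apply: contra ii => li; apply/eqP.
  by apply: spectrum_unique => //; apply: ltW.
pose s := [seq lam i | i <- enum 'I_k].
have charE : char_poly A = \prod_(y <- s) ('X - y%:P).
  by rewrite char_poly_spectral big_map big_enum.
have rootE b : root (char_poly A) b -> exists i, b = lam i.
  by rewrite charE root_prod_XsubC => /mapP[i _ ->]; exists i.
split.
  apply/eqP => d0; have /rootE[i l0] : root (char_poly A) 0.
    by rewrite /root horner_coef0 char_poly_det d0 mulr0.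
  case: (eqVneq i i0) => [ii|/neg]; last by rewrite -l0 ltxx.
  by rewrite -ii -l0 ltxx in li0.
exists (lam i0); split=> //; split.
  by rewrite charE root_prod_XsubC map_f ?mem_enum.
split; last first.
  move=> b b0 /rootE[i bi]; rewrite bi in b0 *.
  by case: (eqVneq i i0) => [->//|/neg]; rewrite ltNge ltW.
rewrite charE mu_prod_XsubC count_map.
rewrite -[RHS](_ : count_mem i0 (enum 'I_k) = 1%N); last first.
  by rewrite count_uniq_mem ?enum_uniq // mem_enum.
apply: eq_count => i /=; apply/eqP/eqP => [li|-> //].
by apply: spectrum_unique; rewrite ?li ltW.
Qed.

End Spectrum.

Lemma nondeg_one_pos_form (R : realType) (k : nat) (A : 'M[R]_k) (v : 'I_k -> R) :
  (forall i j, A i j = A j i) -> 0 < bform A v v ->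
  (forall x, (exists i, x i != 0) -> bform A x v = 0 -> bform A x x < 0) ->
  nondeg_one_pos A.
Proof.
move=> sA v0 v1; have [lam [P [uP eA]]] := sym_spectral sA.
exact: nondeg_one_pos_spectral uP eA v v0 v1.
Qed.

(** * Independence in a delta-matroid and in its enveloping matroid *)

Section Enveloping.
Variables (R : realType) (n : nat) (F Bs : {set {set gset n}}).
Implicit Types (S B C J : {set gset n}) (a : gset n) (y : 'rV[R]_n).
Hypothesis F_size : forall B, B \in F -> admissible B /\ #|B| = n.
Hypotheses (BsM : matroid_bases Bs) (envF : enveloping R F Bs).

Lemma admissibleP S : reflect (forall a, a \in S -> gbar a \notin S) (admissible S).
Proof.
apply: (iffP forallP) => [adm [i b] aS|adm i].
  have := adm i; rewrite /gbar /=.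
  by case: b aS => aS; rewrite aS ?andbT.
by apply/negP => /andP[h]; apply/negP; apply: (adm (i, false)).
Qed.

Lemma gbarK : involutive (@gbar n).
Proof. by case=> i b; rewrite /gbar /= negbK. Qed.

Lemma card_unsigned S : admissible S -> #|unsigned S| = #|S|.
Proof.
move=> /admissibleP adm; apply: card_in_imset => -[i b] [j c] /= iS jS ij.
rewrite -{j}ij in jS *; congr (_, _); apply/eqP/negPn/negP => bc.
have /negP[] := adm _ iS; rewrite /gbar /=.
by rewrite (_ : ~~ b = c) //; move: bc; clear; case: b; case: c.
Qed.

Lemma transversal_gbar B a : admissible B -> #|B| = n ->
  (gbar a \in B) = (a \notin B).
Proof.
move=> adm cB; apply/idP/idP => [gB|aB].
  by have /admissibleP/(_ _ gB) := adm; rewrite gbarK.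
have uT : unsigned B = setT.
  by apply/eqP; rewrite eqEcard subsetT cardsT card_ord card_unsigned // cB leqnn.
have : a.1 \in unsigned B by rewrite uT inE.
case/imsetP => -[j c] jB /= aj; case: a aB aj => i b /= aB ij.
rewrite /gbar /=; rewrite -ij in jB.
by case: b c aB jB => -[] // /negP.
Qed.

(** The linear functional given by the scalar product with [e_S]; its maximum over P(D) tests
    independence of [S]. *)
Definition signed_sum S y : R := \sum_(a in S) (if a.2 then - y 0 a.1 else y 0 a.1).

Lemma signed_sum_env S (x : {ffun gset n -> R}) :
  signed_sum S (env x) = \sum_(a in S) (x a - x (gbar a)).
Proof.
apply: eq_bigr => -[i b] _ /=; rewrite mxE /gbar /=.
by case: b; rewrite ?opprB.
Qed.

Lemma e_setE S i :
  e_set R S 0 i = ((i, false) \in S)%:R - ((i, true) \in S)%:R.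
Proof.
have e_eltE a : e_elt R a 0 i = (a == (i, false))%:R - (a == (i, true))%:R.
  case: a => j b; rewrite /e_elt !mxE /= !xpair_eqE eq_sym.
  by case: b; case: eqP => //=; rewrite ?mulr0 ?mulr1 ?mul1r ?subr0 ?sub0r.
have sum_eq (c : gset n) : \sum_(a in S) (a == c)%:R = (c \in S)%:R :> R.
  have [cS|cS] := boolP (c \in S).
    rewrite (bigD1 c) //= eqxx big1 ?addr0 // => a /andP[_ /negbTE ->] //.
  by rewrite big1 // => a aS; case: eqP => // ac; rewrite -ac aS in cS.
by rewrite summxE; under eq_bigr => a _ do rewrite e_eltE; rewrite sumrB !sum_eq.
Qed.

Lemma sum_mem S B : \sum_(a in S) (a \in B)%:R = #|S :&: B|%:R :> R.
Proof.
rewrite -sum1_card natr_sum (eq_bigl (fun a => (a \in S) && (a \in B))).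
  by rewrite big_mkcondr; apply: eq_bigr => a _; case: ifP.
by move=> a; rewrite inE.
Qed.

Lemma signed_sum_e_set S B :
  signed_sum S (e_set R B) = \sum_(a in S) ((a \in B)%:R - (gbar a \in B)%:R).
Proof.
by apply: eq_bigr => -[i b] _; rewrite e_setE; case: b; rewrite ?opprB.
Qed.

Lemma signed_sum_env_indic S C : signed_sum S (env (indic R C)) =
  \sum_(a in S) ((a \in C)%:R - (gbar a \in C)%:R).
Proof. by rewrite signed_sum_env; apply: eq_bigr => a _; rewrite !ffunE. Qed.

Lemma convex_ge (I : finType) (A : {set I}) (lam g : I -> R) (r : R) :
  (forall i, 0 <= lam i) -> \sum_(i in A) lam i = 1 ->
  r = \sum_(i in A) lam i * g i -> exists2 i, i \in A & r <= g i.
Proof.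
move=> lam0 lam1; set r' := \sum_(i in A) _ => ->.
have [/exists_inP //|/exists_inPn no] := boolP [exists i in A, r' <= g i]; exfalso.
have h i : i \in A -> 0 <= lam i * (r' - g i).
  by move=> iA; rewrite mulr_ge0 // subr_ge0 ltW // ltNge no.
have s0 : \sum_(i in A) lam i * (r' - g i) = 0.
  under eq_bigr => i _ do rewrite mulrBr.
  by rewrite sumrB -mulr_suml lam1 mul1r subrr.
have lz i : i \in A -> lam i = 0.
  move=> iA; have /eqP := psumr_eq0P h s0 iA.
  rewrite mulf_eq0 subr_eq0 => /orP[/eqP //|/eqP e].
  by have := no i iA; rewrite e lexx.
by move: lam1; rewrite big1 // => /esym/eqP; rewrite oner_eq0.
Qed.

Lemma PD_ge S y : PD F y -> exists2 B, B \in F & signed_sum S y <= signed_sum S (e_set R B).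
Proof.
case=> lam [lam0 [lam1 ->]]; apply: (convex_ge lam0 lam1).
rewrite /signed_sum; under [RHS]eq_bigr => B _ do rewrite mulr_sumr.
rewrite exchange_big; apply: eq_bigr => a _ /=.
rewrite summxE; case: a.2; first rewrite -sumrN.
all: by apply: eq_bigr => B _; rewrite mxE ?mulrN.
Qed.

Lemma PM_ge S (x : {ffun gset n -> R}) : PM Bs x ->
  exists2 C, C \in Bs & signed_sum S (env x) <= signed_sum S (env (indic R C)).
Proof.
case=> lam [lam0 [lam1 ->]]; apply: (convex_ge lam0 lam1).
rewrite signed_sum_env; under [RHS]eq_bigr => C _ do rewrite signed_sum_env mulr_sumr.
rewrite exchange_big; apply: eq_bigr => a _ /=.
rewrite !sum_ffunE -sumrB; apply: eq_bigr => C _.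
by rewrite !ffunE -mulrBr.
Qed.

Lemma PD_e_set B : B \in F -> PD F (e_set R B).
Proof.
move=> BF; exists (fun C => (C == B)%:R); split=> [C|]; first exact: ler0n.
split.
  rewrite (bigD1 B) //= eqxx big1 ?addr0 // => C /andP[_ /negbTE ->] //.
rewrite (bigD1 B) //= eqxx big1 ?addr0 ?scale1r // => C /andP[_ /negbTE ->].
by rewrite scale0r.
Qed.

Lemma PM_indic C : C \in Bs -> PM Bs (indic R C).
Proof.
move=> CB; exists (fun C' => (C' == C)%:R); split=> [C'|]; first exact: ler0n.
split.
  rewrite (bigD1 C) //= eqxx big1 ?addr0 // => C' /andP[_ /negbTE ->] //.
rewrite (bigD1 C) //= eqxx big1 ?addr0 ?scale1r // => C' /andP[_ /negbTE ->].
by rewrite scale0r.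
Qed.

(** The functional of [B] takes the value [n] at [e_B], hence at least [n] at the image of some
    basis [C]. Each of its [n] terms is at most 1, so all equal 1, which forces [C = B]. *)
Lemma feasible_basis B : B \in F -> B \in Bs.
Proof.
move=> BF; have [adm cB] := F_size BF.
have [x [xM eB]] : exists x, PM Bs x /\ e_set R B = env x by apply/envF/PD_e_set.
have [C CB] := PM_ge B xM; rewrite -eB signed_sum_e_set signed_sum_env_indic => le.
suff : B = C by move=> ->.
have le1 a : a \in B -> (a \in C)%:R - (gbar a \in C)%:R <= 1 :> R.
  by move=> _; case: (a \in C); case: (gbar a \in C) => /=; lra.
have eq1 a : a \in B -> (a \in C)%:R - (gbar a \in C)%:R = 1 :> R.
  move=> aB; apply/eqP; rewrite eq_sym -subr_eq0; apply/eqP.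
  apply: (psumr_eq0P (P := fun a => a \in B) (F := fun a => 1 - ((a \in C)%:R - (gbar a \in C)%:R)))
    aB => [b bB|]; first by rewrite subr_ge0 le1.
  apply/eqP; rewrite eq_le sumr_ge0 ?andbT; last first.
    by move=> b bB; rewrite subr_ge0 le1.
  rewrite sumrB subr_le0; apply: le_trans le; apply: ler_sum => b bB.
  by rewrite transversal_gbar // bB subr0.
have BC a : a \in B -> (a \in C) && (gbar a \notin C).
  by move=> /eq1; case: (a \in C); case: (gbar a \in C) => //= h; exfalso; move: h; lra.
apply/setP => a; apply/idP/idP => [/BC/andP[]//|aC].
rewrite -[_ \in _]negbK -transversal_gbar //; apply/negP => /BC.
by rewrite gbarK aC andbF.
Qed.

(* Extend [S] by elements of a feasible [B] with [S :&: B] largest to a basis [J].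
   The maximum of [signed_sum S] over [PD F] is [2 * #|S :&: B| - #|S|], while at [J]
   it is at least [#|S :&: B|]. *)
Lemma independent_mindep S : independent F S = admissible S && mindep Bs S.
Proof.
rewrite /independent; have [adm|//] := boolP (admissible S).
rewrite !andTb; apply/idP/idP => [/exists_inP[B /feasible_basis BB SB]|iS].
  by apply/mindepP; exists B.
have [C0 C0B _] := mindepP _ _ iS.
have F0 : exists B, B \in F.
  have [|B BF _] := @PD_ge set0 (env (indic R C0)); last by exists B.
  by apply/envF; exists (indic R C0); split=> //; apply: PM_indic.
have [B1 B1F] := F0.
have [B BF maxB] := arg_maxnP (fun B => #|S :&: B|) B1F.
have [admB cB] := F_size BF.
have BB := feasible_basis BF.
have [J [iJ SJ JSB cJ]] := mrank_extend BsM iS (subsetUl S B).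
have JB : J \in Bs.
  have [C CB JC] := mindepP _ _ iJ; suff -> : J = C by [].
  apply/eqP; rewrite eqEcard JC (card_basis BsM CB BB) cJ.
  by apply: (mrank_indep (Bs := Bs)); [apply/mindepP; exists B|exact: subsetUr].
have [|B' B'F] := @PD_ge S (env (indic R J)).
  by apply/envF; exists (indic R J); split=> //; apply: PM_indic.
have [admB' cB'] := F_size B'F.
rewrite signed_sum_env_indic signed_sum_e_set => le.
(* Elements of [J] outside [S] lie in [B], so [a] in [S :&: B] has [gbar a] outside [J] and
   contributes 1; the other terms are nonnegative. *)
have lower : #|S :&: B|%:R <= \sum_(a in S) ((a \in J)%:R - (gbar a \in J)%:R) :> R.
  rewrite -sum_mem; apply: ler_sum => a aS; rewrite (subsetP SJ a aS).
  have : gbar a \in J -> a \notin B.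
    move=> /(subsetP JSB); rewrite inE (negbTE (admissibleP _ adm a aS)) /=.
    by rewrite transversal_gbar.
  case: (gbar a \in J) => [/(_ isT)/negbTE ->|_]; first by rewrite subrr.
  by rewrite subr0 ler_nat leq_b1.
have upper : \sum_(a in S) ((a \in B')%:R - (gbar a \in B')%:R) =
   2 * #|S :&: B'|%:R - #|S|%:R :> R.
  rewrite -sum_mem -sum1_card natr_sum mulr_sumr -sumrB; apply: eq_bigr => a _.
  by rewrite transversal_gbar //; case: (a \in B') => /=; lra.
(* This gives [#|S :&: B| + #|S| <= 2 * #|S :&: B'|], and maximality of [B] turns it into
   [#|S| <= #|S :&: B|]. *)
have := le_trans lower le; rewrite upper lerBrDr -natrM -natrD ler_nat => {le lower upper} le.
apply/exists_inP; exists B => //; apply/setIidPl/eqP; rewrite eqEcard subsetIl.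
have le' : (#|S :&: B'| <= #|S :&: B|)%N := maxB B' B'F.
by rewrite /=; move: #|S :&: B| #|S :&: B'| #|S| le le' => x y z; clear; lia.
Qed.

End Enveloping.

(** * From symmetric functions on words to polynomials *)

Section TensorPolynomial.
Variables (R : realType) (k : nat).
Implicit Types (m : 'X_{1..k}) (s : seq 'I_k) (f : {mpoly R[k]}).

Definition mfact m : nat := \prod_i (m i)`!.

Lemma mfact_gt0 m : (0 < mfact m)%N.
Proof. by apply: prodn_gt0 => i; apply: fact_gt0. Qed.

Lemma mfactU m i : mfact (m + U_(i))%MM = ((m i).+1 * mfact m)%N.
Proof.
rewrite /mfact (bigD1 i) // [in RHS](bigD1 i) //= mulnA mnmDE mnm1E eqxx addn1 factS.
congr (_ * _)%N; apply: eq_bigr => j /negbTE ji.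
by rewrite mnmDE mnm1E eq_sym ji addn0.
Qed.

Definition mlist m : seq 'I_k := flatten [seq nseq (m i) i | i <- enum 'I_k].

Lemma count_mlist m i : count_mem i (mlist m) = m i.
Proof.
rewrite count_flatten -map_comp sumnE big_map big_enum (bigD1 i) //= count_nseq /=.
rewrite eqxx mul1n big1 ?addn0 // => j /negbTE ji.
by rewrite count_nseq /= ji.
Qed.

Lemma size_mlist m : size (mlist m) = mdeg m.
Proof.
rewrite size_flatten /shape -map_comp sumnE big_map big_enum mdegE.
by apply: eq_bigr => i _; rewrite /= size_nseq.
Qed.

Definition mnm_of s : 'X_{1..k} := (\sum_(i <- s) U_(i))%MM.

Lemma mnm_ofE s i : mnm_of s i = count_mem i s.
Proof.
rewrite mnm_sumE; elim: s => [|j s IH]; first by rewrite big_nil.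
by rewrite big_cons IH mnm1E.
Qed.

Lemma mdeg_mnm_of s : mdeg (mnm_of s) = size s.
Proof. by rewrite mdeg_sum (eq_bigr _ (fun i _ => mdeg1 i)) sum1_size. Qed.

Lemma perm_mlist s : perm_eq (mlist (mnm_of s)) s.
Proof. by apply/allP => i _ /=; rewrite count_mlist mnm_ofE. Qed.

Lemma mfact_mderiv f m i :
  (mfact m)%:R * f^`M(i)@_m = (mfact (m + U_(i))%MM)%:R * f@_(m + U_(i)).
Proof. by rewrite mcoeff_mderiv mfactU natrM -mulr_natl; ring. Qed.

(** For coefficients multiplied by the factorials of their exponents, differentiation is a shift of
    exponents. *)
Lemma mfact_mderivs f s m : (mfact m)%:R * (foldr (fun i g => g^`M(i)) f s)@_m =
  (mfact (m + mnm_of s)%MM)%:R * f@_(m + mnm_of s).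
Proof.
elim: s m => [|i s IH] m /=; first by rewrite /mnm_of big_nil addm0.
by rewrite mfact_mderiv IH /mnm_of big_cons addmA.
Qed.

Lemma meval_at0 f : f.@[fun=> 0] = f@_0%MM.
Proof.
rewrite mevalE {3}[f]mpolyE raddf_sum /=; apply: eq_bigr => m _.
rewrite mcoeffZ mcoeffX; congr (_ * _).
have [->|m0] := eqVneq m 0%MM; first by rewrite big1 // => i _; rewrite mnm0E expr0.
case: (pickP (fun i => m i != 0%N)) => [i mi|mz].
  by rewrite (bigD1 i) //= expr0n (negbTE mi) mul0r.
by case/eqP: m0; apply/mnmP => i; rewrite mnm0E; apply/eqP; have := mz i; case: eqP.
Qed.

Definition tensor_poly (d : nat) (t : seq 'I_k -> R) : {mpoly R[k]} :=
  \sum_(m : 'X_{1..k < d.+1})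
     (if mdeg m == d then t (mlist m) / (mfact m)%:R else 0) *: 'X_[m].

Lemma tensor_poly_homog d t : tensor_poly d t \is d.-homog.
Proof.
apply: rpred_sum => m _; case: ifP => [md|_]; last by rewrite scale0r dhomog0.
by apply: dhomogZ; rewrite dhomogX.
Qed.

Lemma mcoeff_tensor_poly d t m : (tensor_poly d t)@_m =
  if mdeg m == d then t (mlist m) / (mfact m)%:R else 0.
Proof.
have [dm|dm] := ltnP (mdeg m) d.+1.
  rewrite (mcoeff_mpoly (fun m => if mdeg m == d then t (mlist m) / (mfact m)%:R else 0)) //.
rewrite (dhomog_nemf_coeff (tensor_poly_homog d t)) ?gtn_eqF //.
Qed.

Lemma quad_matrix_tensor_poly d t s i j : symf t -> (size s + 2)%N = d ->
  quad_matrix (foldr (fun i g => g^`M(i)) (tensor_poly d t) s) i j =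
  2^-1 * t [:: i, j & s].
Proof.
move=> st sd; rewrite mxE meval_at0; congr (_ * _).
have := mfact_mderivs (tensor_poly d t) [:: i, j & s] 0%MM.
have -> : mfact 0%MM = 1%N by rewrite /mfact big1 // => l _; rewrite mnm0E.
rewrite mul1r add0m /= => ->.
rewrite mcoeff_tensor_poly mdeg_mnm_of /= -sd addn2 eqxx mulrCA divff ?mulr1.
  by apply: st; apply: perm_mlist.
by rewrite pnatr_eq0 -lt0n mfact_gt0.
Qed.

End TensorPolynomial.

(** * Nondegeneracy by shrinking the diagonal *)

Section Shrink.
Variables (R : realType) (k : nat).

(* Shrinking the diagonal entries other than the first makes a form with at most one
   positive eigenvalue negative definite on the hyperplane orthogonal to [e_0]. *)
Lemma nondeg_shrunk (M A : 'M[R]_k.+1) (d : 'I_k.+1 -> R) (kap h : R) :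
  (forall i j, M i j = M j i) -> (forall i j, 0 < M i j) -> lor M ->
  (forall i, 0 < d i) -> 0 < kap -> 0 < h < 1 ->
  (forall i j, A i j = kap * (d i * d j * h ^+ ((i == j) && (i != 0)) * M i j)) ->
  nondeg_one_pos A.
Proof.
move=> sM M0 lM d0 kap0 /andP[h0 h1] AE.
pose v (i : 'I_k.+1) : R := (i == 0)%:R.
have formv (N : 'M[R]_k.+1) x : bform N x v = \sum_i x i * N i 0.
  apply: eq_bigr => i _; rewrite (bigD1 0) //= /v eqxx mulr1 big1 ?addr0 // => j.
  by move=> /negbTE ->; rewrite mulr0.
have formvv (N : 'M[R]_k.+1) : bform N v v = N 0 0.
  rewrite formv (bigD1 0) //= /v eqxx mul1r big1 ?addr0 // => j.
  by move=> /negbTE ->; rewrite mul0r.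
apply: (nondeg_one_pos_form (v := v)).
- by move=> i j; rewrite !AE sM [j == i]eq_sym; case: eqP => [-> //|_] /=; ring.
- by rewrite formvv AE !mulr_gt0 ?exprn_gt0.
move=> x [i0 xi0] xv; pose y i := d i * x i.
(* Column 0 is not shrunk, so [A]-orthogonality of [x] to [e_0] is [M]-orthogonality of [y] to
   [e_0]. *)
have Ai0 i : A i 0 = kap * (d i * d 0 * M i 0).
  by rewrite AE; case: eqP => [->|_] /=; rewrite ?eqxx /= expr0; ring.
have yv : \sum_i y i * M i 0 = 0.
  have : kap * d 0 * \sum_i y i * M i 0 = 0.
    rewrite mulr_sumr -[RHS]xv formv; apply: eq_bigr => i _; rewrite Ai0 /y; ring.
  by move=> /eqP; rewrite !mulf_eq0 (gt_eqF kap0) (gt_eqF (d0 _)) => /eqP.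
have yMy : bform M y y <= 0.
  have := lM y v; rewrite formvv formv yv expr0n /= => /(_ (M0 0 0)).
  by rewrite pmulr_lle0.
have Axx : bform A x x =
    kap * (bform M y y - (1 - h) * \sum_(i | i != 0) M i i * y i ^+ 2).
  rewrite /bform (big_mkcond (fun i => i != 0)) mulr_sumr -sumrB mulr_sumr.
  apply: eq_bigr => i _.
  rewrite (_ : (if i != 0 then M i i * y i ^+ 2 else 0) =
    \sum_j ((i == j) && (i != 0))%:R * (y i * M i j * y j)).
    rewrite mulr_sumr -sumrB mulr_sumr; apply: eq_bigr => j _; rewrite AE /y.
    by case: (_ && _) => /=; ring.
  rewrite (bigD1 i) //= eqxx /= big1 ?addr0 => [|j].
    by case: eqP => _ /=; ring.
  by rewrite eq_sym => /negbTE -> /=; rewrite mul0r.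
rewrite Axx pmulr_rlt0 // subr_lt0; apply: le_lt_trans yMy _.
rewrite pmulr_rgt0 ?subr_gt0 //.
have sq0 i : 0 <= M i i * y i ^+ 2 by rewrite mulr_ge0 ?sqr_ge0 ?ltW.
(* Strictness: if the diagonal sum vanished, [y] would be supported at 0, and orthogonality with
   [M 0 0 > 0] would give [y 0 = 0]. *)
rewrite lt_def sumr_ge0 ?andbT //; apply/eqP => s0.
have yz i : i != 0 -> y i = 0.
  move=> i1; have /eqP := psumr_eq0P (fun i _ => sq0 i) s0 i1.
  by rewrite mulf_eq0 (gt_eqF (M0 _ _)) sqrf_eq0 => /eqP.
have y0 : y 0 = 0.
  move: yv; rewrite (bigD1 0) //= big1 ?addr0 => [/eqP|i /yz ->]; last by rewrite mul0r.
  by rewrite mulf_eq0 (gt_eqF (M0 0 0)) orbF => /eqP.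
have : y i0 = 0 by case: (eqVneq i0 0) => [->|/yz].
by move=> /eqP; rewrite mulf_eq0 (gt_eqF (d0 _)) (negbTE xi0).
Qed.

End Shrink.

(** * Limits at 0 of functions polynomial in the parameter *)

Section PolynomialFunctions.
Variable R : realType.

Definition polyfun (phi : R -> R) := exists p : {poly R}, forall h, phi h = p.[h].

Lemma polyfun_cst a : polyfun (fun=> a).
Proof. by exists a%:P => h; rewrite hornerC. Qed.

Lemma polyfunX n : polyfun (fun h => h ^+ n).
Proof. by exists 'X^n => h; rewrite hornerXn. Qed.

Lemma polyfunD f g : polyfun f -> polyfun g -> polyfun (fun h => f h + g h).
Proof. by case=> p pE [q qE]; exists (p + q) => h; rewrite hornerD pE qE. Qed.

Lemma polyfunM f g : polyfun f -> polyfun g -> polyfun (fun h => f h * g h).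
Proof. by case=> p pE [q qE]; exists (p * q) => h; rewrite hornerM pE qE. Qed.

Lemma polyfun_sum (I : Type) (r : seq I) (f : R -> I -> R) :
  (forall i, polyfun (f^~ i)) -> polyfun (fun h => \sum_(i <- r) f h i).
Proof.
move=> pf; elim: r => [|i r [p pE]].
  by exists 0 => h; rewrite big_nil horner0.
have [q qE] := pf i; exists (q + p) => h.
by rewrite big_cons hornerD -pE -qE.
Qed.

Lemma polyfun_pull (K K' : finType) (B : R -> K' -> K -> R) (c : R -> seq K -> R) I :
  (forall i l, polyfun (fun h => B h i l)) -> (forall J, polyfun (c^~ J)) ->
  polyfun (fun h => pull (B h) (c h) I).
Proof.
move=> pB pc; rewrite /pull; move: [::] => J.
elim: I c pc J => [|i I IH] c pc J //=.
apply: (IH (fun h => contr (B h i) (c h))) => L; apply: polyfun_sum => l.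
by apply: polyfunM.
Qed.

Lemma poly_bounded (p : {poly R}) :
  exists2 C, 0 <= C & forall h, 0 <= h <= 1 -> `|p.[h]| <= C.
Proof.
elim/poly_ind: p => [|p c [C C0 pC]].
  by exists 0 => // h _; rewrite horner0 normr0.
exists (C + `|c|) => [|h h01]; first exact: addr_ge0.
rewrite hornerMXaddC; apply: le_trans (ler_normD _ _) _; rewrite lerD2r normrM.
have /andP[h0 h1] := h01; rewrite -[leRHS]mulr1 ler_pM ?pC //.
by rewrite ger0_norm.
Qed.

(** [p - p(0)] is divisible by [X], with a quotient bounded on the unit interval. *)
Lemma polyfun_cvg0 f : polyfun f -> forall eps, 0 < eps ->
  exists N0, forall N, (N0 <= N)%N -> `|f N.+2%:R^-1 - f 0| < eps.
Proof.
case=> p pE eps eps0.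
have /factor_theorem[r rE] : root (p - p.[0]%:P) 0.
  by rewrite /root hornerD hornerN hornerC subrr.
have [C C0 rC] := poly_bounded r.
exists (Num.bound (C / eps)) => N leN; rewrite !pE.
have -> : p.[N.+2%:R^-1] - p.[0] = r.[N.+2%:R^-1] * N.+2%:R^-1.
  have := congr1 (fun q => q.[N.+2%:R^-1]) rE.
  by rewrite hornerM !hornerD !hornerN !hornerC hornerX subr0.
have N0 : 0 < N.+2%:R :> R by [].
rewrite normrM (@ger0_norm _ (_^-1)) ?invr_ge0 ?ltW // ltr_pdivrMr //.
apply: le_lt_trans (rC _ _) _.
  by rewrite invr_ge0 ltW //= invf_le1 // ler1n.
rewrite mulrC -ltr_pdivrMr //; apply: lt_le_trans (archi_boundP _) _.
  by rewrite divr_ge0 // ltW.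
by rewrite ler_nat; apply: leq_trans leN _; rewrite ltnW // ltnW.
Qed.

End PolynomialFunctions.

(** * The strictly Lorentzian approximants and their limit *)

Section Approximation.
Variables (R : realType) (n : nat) (Bs : {set {set gset n}}).
Hypothesis BsM : matroid_bases Bs.

(* The substitution sending both variables [(j, false)] and [(j, true)] to [lift ord0 j],
   perturbed so as to be entrywise positive. *)
Definition spread (h : R) (i : 'I_n.+1) (k : option (gset n)) : R :=
  h + match unlift ord0 i, k with
      | None, None => 1
      | Some j, Some e => (e.1 == j)%:R
      | _, _ => 0
      end.

Definition excess (I : seq 'I_n.+1) : nat :=
  \sum_(i < n) 'C(count_mem (lift ord0 i) I, 2).

(** One parameter drives all three deformations. At [h = 0], with the convention [0 ^+ 0 = 1], both
    powers become indicators: of multiaffinity outside variable 0, and of independence in the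
    matroid. *)
Definition indep_tensor (h : R) (I : seq 'I_n.+1) : R :=
  h ^+ excess I * pull (spread h) (tutte_tensor Bs h) I.

Lemma spread_gt0 h i k : 0 < h -> 0 < spread h i k.
Proof.
by move=> h0; rewrite /spread ltr_pwDl //; case: unlift k => [j|] [e|] //=; rewrite ler0n.
Qed.

Lemma excess_perm I J : perm_eq I J -> excess I = excess J.
Proof. by move=> /permP IJ; apply: eq_bigr => i _; rewrite IJ. Qed.

Definition repeats (i : 'I_n.+1) (I : seq 'I_n.+1) : nat :=
  if i == 0 then 0%N else count_mem i I.

Lemma excess_cons i I : excess (i :: I) = (excess I + repeats i I)%N.
Proof.
rewrite /excess /repeats; case: (unliftP ord0 i) => [j|] ->.
  have -> : (lift ord0 j == 0) = false by rewrite eq_sym; apply/negbTE/neq_lift.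
  rewrite (bigD1 j) //= [in RHS](bigD1 j) //= eqxx.
  rewrite add1n binS bin1 -!addnA; congr (_ + _)%N; rewrite addnC; congr (_ + _)%N.
  apply: eq_bigr => l /negbTE lj.
  by rewrite (inj_eq lift_inj) eq_sym lj add0n.
rewrite eqxx addn0; apply: eq_bigr => l _ /=.
by rewrite add0n.
Qed.

(** The terms linear in [i] and in [j] rescale rows and columns of the Hessian; the mixed second
    difference is 1 exactly on the diagonal away from 0. This is the shape required by
    [nondeg_shrunk]. *)
Lemma excess_cons2 i j I : excess [:: i, j & I] =
  (excess I + repeats i I + repeats j I + ((i == j) && (i != 0%R)))%N.
Proof.
rewrite !excess_cons {2}/repeats /= /repeats [j == i]eq_sym.
by case: (eqVneq i 0) => _; case: (i == j) => /=; lia.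
Qed.

Lemma indep_tensor_sym h : symf (indep_tensor h).
Proof.
move=> I J IJ; rewrite /indep_tensor (excess_perm IJ).
by congr (_ * _); apply: (pull_sym _ _ IJ); apply: tutte_sym.
Qed.

Lemma indep_tensor_strict h : 0 < h < 1 ->
  strictly_lorentzian (2 * n) (tensor_poly (2 * n) (indep_tensor h)).
Proof.
(* For [n = 0] the degree is 0 and there is no Hessian to examine; otherwise the degree has the form
   [s.+2]. *)
move=> /andP[h0 h1]; have [n0|n0] := posnP n.
  split; first exact: tensor_poly_homog.
  have n20 : (2 * n)%N = 0%N by rewrite n0 muln0.
  split=> [m dm|d2]; last by exfalso; move: d2; rewrite n20.
  rewrite mcoeff_tensor_poly dm eqxx divr_gt0 ?ltr0n ?mfact_gt0 //.
  have -> : mlist m = [::] by apply: size0nil; rewrite size_mlist dm n20.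
  by rewrite mulr_gt0 ?exprn_gt0 // /pull /= /tutte_tensor /= mulr_gt0 ?exprn_gt0.
have lT := tutte_lor_multiaffine BsM h0 (ltW h1).
have Bpos i k : 0 < spread h i k by apply: spread_gt0.
have cT : #|{: gset n}| = (2 * n - 2).+2.
  by rewrite card_prod card_ord card_bool; lia.
rewrite cT in lT.
split; first exact: tensor_poly_homog.
split=> [m dm|_ s ss].
  rewrite mcoeff_tensor_poly dm eqxx divr_gt0 ?ltr0n ?mfact_gt0 //.
  rewrite mulr_gt0 ?exprn_gt0 //; apply: (pull_gt0 Bpos lT).
  by rewrite size_mlist dm; lia.
apply: (nondeg_shrunk (M := \matrix_(i, j) pull (spread h) (tutte_tensor Bs h) [:: i, j & s])
  (d := fun i => h ^+ repeats i s) (kap := 2^-1 * h ^+ excess s) (h := h)).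
- move=> i j; rewrite !mxE; apply: pull_sym; first exact: tutte_sym.
  exact/permP/(fun a => addnCA _ _ _).
- by move=> i j; rewrite mxE; apply: (pull_gt0 Bpos lT); rewrite /= ss.
- by apply: eq_lor _ (pull_lor Bpos lT ss) => i j; rewrite mxE.
- by move=> i; apply: exprn_gt0.
- by rewrite mulr_gt0 ?invr_gt0 ?exprn_gt0.
- by rewrite h0.
move=> i j; rewrite quad_matrix_tensor_poly; last 2 first.
- exact: indep_tensor_sym.
- by rewrite ss; lia.
rewrite mxE /indep_tensor excess_cons2 !exprD.
by move: (pull _ _ _) (h ^+ excess s) (h ^+ repeats i s) (h ^+ repeats j s) (h ^+ (_ && _))
  => a b c d e; ring.
Qed.

Lemma indep_tensor_polyfun I : polyfun (indep_tensor^~ I).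
Proof.
apply: polyfunM; first exact: polyfunX.
apply: polyfun_pull => [i k|J]; last first.
  rewrite /tutte_tensor; case: (mult_free J); last exact: polyfun_cst.
  by apply: polyfunM; [apply: polyfun_cst | apply: polyfunX].
by apply: polyfunD; [apply: (polyfunX _ 1) | apply: polyfun_cst].
Qed.

Section Limit.
Let B0 := spread 0.

Lemma contr_spread0 c J : contr (B0 ord0) c J = c (None :: J).
Proof.
rewrite /contr big_option /B0 /spread unlift_none add0r mul1r big1 ?addr0 // => e _.
by rewrite ?add0r ?addr0 mul0r.
Qed.

Lemma contr_spread_lift (i : 'I_n) c J :
  contr (B0 (lift ord0 i)) c J = c (Some (i, false) :: J) + c (Some (i, true) :: J).
Proof.
rewrite /contr big_option /B0 /spread liftK !add0r mul0r add0r.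
transitivity (\sum_(j < n) \sum_(b : bool) (j == i)%:R * c (Some (j, b) :: J)).
  by rewrite pair_bigA; apply: eq_bigr => -[j b] _; rewrite add0r.
rewrite (bigD1 i) //= big_bool /= eqxx !mul1r big1 ?addr0 1?addrC // => j.
by move=> /negbTE ji; rewrite big_bool /= ji !mul0r addr0.
Qed.

Lemma pull_spread_nseq0 a c I :
  pull B0 c (nseq a ord0 ++ I) = pull B0 (fun J => c (nseq a None ++ J)) I.
Proof.
rewrite /pull map_cat; elim: a c => //= a IH c.
by rewrite IH; apply: contrs_ext => J; rewrite contr_spread0.
Qed.

Lemma unsigned_setU1 (e : gset n) S : unsigned (e |: S) = e.1 |: unsigned S.
Proof. exact: imsetU1. Qed.

(** Adding [(i, b)] is a bijection from the admissible sets over [L] to those over [i |: L] that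
    contain [(i, b)]. *)
Lemma admissible_setU1 i b (L : {set 'I_n}) (S : {set gset n}) : i \notin L ->
  [&& admissible ((i, b) |: S), unsigned ((i, b) |: S) == i |: L & (i, b) \notin S] =
  admissible S && (unsigned S == L).
Proof.
move=> iL; rewrite unsigned_setU1 /=; apply/and3P/andP => [[adm /eqP uS ibS]|[adm /eqP uS]].
  have iS : i \notin unsigned S.
    apply/imsetP => -[[j c] jS /= ij]; rewrite -{j}ij in jS.
    have /admissibleP/(_ (i, b)) := adm; rewrite /gbar !inE eqxx /= => /(_ isT).
    rewrite negb_or => /andP[_]; case: b c ibS jS {adm uS} => -[] //.
      by move=> /negP.
      by move=> _ ->.
      by move=> _ ->.
    by move=> /negP.
  split; first apply/admissibleP => a aS.
    have /admissibleP/(_ a) := adm; rewrite inE aS orbT => /(_ isT).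
    by rewrite inE negb_or => /andP[].
  apply/eqP/setP => j; have := congr1 (fun X : {set 'I_n} => j \in X) uS; rewrite !inE.
  by case: (eqVneq j i) => [->|//]; rewrite (negbTE iS) (negbTE iL).
have nS c : (i, c) \notin S.
  by apply: contra iL => icS; rewrite -uS; apply/imsetP; exists (i, c).
split=> //; last by rewrite uS.
apply/admissibleP => a; rewrite in_setU1 => /orP[/eqP ->|aS].
  by rewrite /gbar in_setU1 negb_or nS andbT /=; apply/eqP => -[]; case: b.
rewrite in_setU1 negb_or ((admissibleP _ adm) a aS) andbT.
apply/eqP => ga; have := nS (~~ b); apply/negP/negPn.
by rewrite (_ : (i, ~~ b) = a) //; rewrite -(gbarK a) ga.
Qed.

(** At [h = 0] each index of [L] contributes a choice between [(i, false)] and [(i, true)]; the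
    families of choices are the admissible sets with unsigned version [L]. *)
Lemma pull_spread_lift c (L : seq 'I_n) : symf c -> uniq L ->
  pull B0 c (map (lift ord0) L) =
  \sum_(S : {set gset n} | admissible S && (unsigned S == [set i in L]))
    c (map Some (enum S)).
Proof.
elim: L c => [|i L IH] c sc /=.
  move=> _; rewrite (big_pred1 set0) ?enum_set0 // => S /=.
  apply/andP/eqP => [[_ /eqP uS]|->].
    apply/eqP; rewrite -subset0; apply/subsetP => a aS.
    have : a.1 \in unsigned S by apply: imset_f.
    by rewrite uS !inE.
  split; last by rewrite /unsigned imset0; apply/eqP/setP => i; rewrite !inE.
  by apply/admissibleP => a; rewrite inE.
move=> /andP[iL uL].
have sc' : symf (contr (B0 (lift ord0 i)) c) by apply: contr_sym.
rewrite -[LHS]/(pull B0 (contr (B0 (lift ord0 i)) c) (map (lift ord0) L)) (IH _ sc' uL).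
rewrite (eq_bigr _ (fun S _ => contr_spread_lift i c _)).
rewrite big_split /=.
set P := fun S : {set gset n} => admissible S && (unsigned S == [set j in i :: L]).
have setL : [set j in i :: L] = i |: [set j in L] by apply/setP => j; rewrite !inE.
have iL' : i \notin [set j in L] by rewrite inE.
have part b : \sum_(S : {set gset n} | admissible S && (unsigned S == [set j in L]))
     c [seq Some x | x <- (i, b) :: enum S] =
   \sum_(S | P S && ((i, b) \in S)) c (map Some (enum S)).
  rewrite [RHS](reindex_onto (fun S => (i, b) |: S) (fun S => S :\ (i, b))); last first.
    by move=> S /andP[_ ibS]; rewrite setD1K.
  apply: eq_big => [S|S PS].
    rewrite -(@admissible_setU1 i b _ _ iL') /P setL -!andbA setU11 /=.
    congr (_ && (_ && _)); apply/idP/eqP => [ibS|<-]; first by rewrite setU1K.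
    by rewrite setD11.
  have ibS : (i, b) \notin S.
    by move: PS; rewrite -(@admissible_setU1 i b _ _ iL') => /and3P[].
  apply: sc; apply: perm_map; apply: uniq_perm; rewrite /= ?enum_uniq ?andbT ?mem_enum //.
  by move=> x; rewrite inE !mem_enum !inE.
rewrite (part false) (part true) [RHS](bigID (fun S : {set gset n} => (i, false) \in S)) /=.
congr (_ + _); apply: eq_bigl => S; rewrite /P; case: (boolP (admissible S)) => //= adm.
case: eqP => //= uS; apply/idP/idP => iS.
  by have := (admissibleP _ adm) _ iS.
have : i \in unsigned S by rewrite uS !inE eqxx.
case/imsetP => -[j [] /=] jS ij; first by rewrite ij.
by rewrite ij jS in iS.
Qed.

End Limit.

Lemma tutte_tensor0 a (S : {set gset n}) :
  tutte_tensor Bs (0 : R) (nseq a None ++ map Some (enum S)) = a`!%:R * (mindep Bs S)%:R.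
Proof.
have pE : pmap id (nseq a None ++ map Some (enum S)) = enum S.
  by elim: a => [|a IH] //=; rewrite map_pK.
rewrite /tutte_tensor /mult_free pE enum_uniq expr0n mnull_eq0 //.
have -> : [set x in enum S] = S by apply/setP => x; rewrite inE mem_enum.
rewrite count_cat count_nseq mul1n [X in (_ + X)%N](_ : _ = 0%N) ?addn0 //.
by rewrite count_map; apply/eqP; rewrite -leqn0 leqNgt -has_count; apply/hasPn.
Qed.

End Approximation.

(** * Coefficients of the independence polynomial *)

Section IndepPolynomial.
Variables (R : realType) (n : nat) (F Bs : {set {set gset n}}).
Implicit Types (S : {set gset n}) (m : 'X_{1..n.+1}).

Definition indep_mnm S : 'X_{1..n.+1} :=
  (U_(ord0) *+ (2 * n - #|S|) + \sum_(i in unsigned S) U_(lift ord0 i))%MM.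

Lemma mcoeff_indep_poly m : (indep_poly R F)@_m =
  \sum_(S : {set gset n} | independent F S) (indep_mnm S == m)%:R.
Proof.
rewrite /indep_poly raddf_sum /=; apply: eq_bigr => S _.
by rewrite mpolyXn mprodXE -mpolyXD mcoeffX.
Qed.

Lemma indep_mnm0 S : indep_mnm S ord0 = (2 * n - #|S|)%N.
Proof.
rewrite mnmDE mulmnE mnm1E eqxx mul1n mnm_sumE big1 ?addn0 // => i _.
by rewrite mnm1E.
Qed.

Lemma indep_mnm_lift S i : indep_mnm S (lift ord0 i) = (i \in unsigned S).
Proof.
rewrite mnmDE mulmnE mnm1E mul0n add0n mnm_sumE.
have [iS|iS] := boolP (i \in unsigned S).
  rewrite (bigD1 i) //= mnm1E eqxx big1 // => j /andP[_ ji].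
  by rewrite mnm1E (inj_eq lift_inj) (negbTE ji).
rewrite big1 // => j jS; rewrite mnm1E (inj_eq lift_inj).
by case: eqP => // ji; rewrite -ji jS in iS.
Qed.

Lemma mnm_succP m m' :
  m ord0 = m' ord0 -> (forall i : 'I_n, m (lift ord0 i) = m' (lift ord0 i)) -> m = m'.
Proof. by move=> m0 ml; apply/mnmP => j; case: (unliftP ord0 j) => [i|] ->. Qed.

Hypothesis indepE : forall S, independent F S = admissible S && mindep Bs S.
Hypothesis BsM : matroid_bases Bs.

(** If some variable other than the first has exponent above 1, both sides vanish. Otherwise the
    factorial of the exponent of [w_0] cancels, and both sides count the independent sets with a
    given unsigned version. *)
Lemma mcoeff_indep_tensor0 m : mdeg m = (2 * n)%N ->
  indep_tensor Bs (0 : R) (mlist m) / (mfact m)%:R = (indep_poly R F)@_m.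
Proof.
move=> dm; rewrite mcoeff_indep_poly /indep_tensor.
case: (pickP (fun i : 'I_n => 1 < m (lift ord0 i))%N) => [i mi|m1].
  rewrite expr0n; have -> : (excess (mlist m) == 0)%N = false.
    apply/negbTE; rewrite -lt0n /excess (bigD1 i) //= count_mlist.
    by rewrite addn_gt0 bin_gt0 mi.
  rewrite !mul0r big1 // => S _; case: eqP => // mS.
  by move: mi; rewrite -mS indep_mnm_lift; case: (_ \in _).
have {}m1 i : (m (lift ord0 i) <= 1)%N by rewrite leqNgt m1.
pose L := [seq i <- enum 'I_n | m (lift ord0 i) == 1%N].
have uL : uniq L by rewrite filter_uniq ?enum_uniq.
have mL (i : 'I_n) : m (lift ord0 i) = (i \in L).
  by rewrite mem_filter mem_enum andbT; have := m1 i; case: (m _) => [|[]].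
have ex0 : excess (mlist m) = 0%N.
  by rewrite /excess big1 // => i _; rewrite count_mlist bin_small // ltnS.
have fm : mfact m = (m ord0)`!.
  rewrite /mfact big_ord_recl big1 ?muln1 // => i _.
  by rewrite mL; case: (i \in L).
have pm : perm_eq (mlist m) (nseq (m ord0) ord0 ++ map (lift ord0) L).
  apply/allP => j _ /=; rewrite count_mlist count_cat count_nseq.
  case: (unliftP ord0 j) => [i|] ->; rewrite /= ?eqxx.
    rewrite mul0n add0n count_map mL -count_uniq_mem //; apply/eqP/eq_count => l.
  rewrite mul1n [X in (_ + X)%N](_ : _ = 0%N) ?addn0 //.
  by apply/eqP; rewrite -leqn0 leqNgt -has_count; apply/hasPn => l /mapP[i _ ->].
rewrite ex0 expr0 mul1r (pull_sym _ (tutte_sym _ _) pm) pull_spread_nseq0.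
rewrite pull_spread_lift //; last first.
  by move=> I J IJ; apply: tutte_sym; rewrite perm_cat2l.
rewrite (eq_bigr _ (fun S _ => tutte_tensor0 R BsM (m ord0) S)) -mulr_sumr fm.
rewrite mulrAC divff ?mul1r ?pnatr_eq0 -?lt0n ?fact_gt0 //.
rewrite big_mkcond [RHS]big_mkcond; apply: eq_bigr => S _; rewrite indepE.
case: (boolP (admissible S)) => //= adm.
suff -> : (unsigned S == [set i in L]) = (indep_mnm S == m).
  by case: (_ == m); case: (mindep Bs S).
apply/eqP/eqP => [uS|mS]; last first.
  by apply/setP => i; rewrite inE; have := mL i; rewrite -mS indep_mnm_lift; do 2!case: (_ \in _).
apply: mnm_succP => [|i]; last by rewrite indep_mnm_lift mL uS inE.
rewrite indep_mnm0 -card_unsigned // uS.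
move: dm; rewrite mdegE big_ord_recl => <-.
rewrite (eq_bigr (fun i => (i \in L) : nat)) => [|i _]; last by rewrite mL.
by rewrite -sum1dep_card [X in (_ - X)%N]big_mkcond /= addnK.
Qed.

End IndepPolynomial.

Theorem theorem3p14 (R : realType) (n : nat) (F : {set {set gset n}}) :
  delta_matroid R F ->
  (exists Bs : {set {set gset n}}, matroid_bases Bs /\ enveloping R F Bs) ->
  lorentzian (2 * n) (indep_poly R F).
Proof.
move=> [_ [F_size _]] [Bs [BsM envF]].
have indepE := independent_mindep F_size BsM envF.
(* The parameter [1 / (N + 2)] lies strictly between 0 and 1 for every [N]. *)
exists (fun N => tensor_poly (2 * n) (indep_tensor Bs N.+2%:R^-1)); split=> [N|m eps eps0].
  apply: (indep_tensor_strict BsM).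
  by rewrite invr_gt0 ltr0n /= invf_lt1 ?ltr0n // ltr1n.
have [dm|dm] := eqVneq (mdeg m) (2 * n)%N; last first.
  exists 0%N => N _; rewrite mcoeff_tensor_poly (negbTE dm) mcoeff_indep_poly.
  rewrite big1 ?subrr ?normr0 // => S; rewrite indepE => /andP[adm _].
  case: eqP => // mS; case/eqP: dm.
  (* An admissible [S] has at most [n] elements, so the truncated subtraction is exact and its term
     has degree [2 * n]. *)
  rewrite -mS mdegE big_ord_recl indep_mnm0.
  under eq_bigr => i _ do rewrite indep_mnm_lift.
  rewrite -card_unsigned // -sum1_card [X in (_ - X)%N]big_mkcond /= subnK //.
  rewrite -big_mkcond sum1_card; apply: leq_trans (max_card _) _.
  by rewrite card_ord leq_pmull.
have [|N0 N0P] := @polyfun_cvg0 R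
  (fun h => indep_tensor Bs h (mlist m) / (mfact m)%:R) _ eps eps0.
  by apply: polyfunM; [exact: indep_tensor_polyfun | exact: polyfun_cst].
exists N0 => N /N0P; rewrite (mcoeff_indep_tensor0 R indepE BsM dm).
by rewrite mcoeff_tensor_poly dm eqxx.
Qed.
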